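(* Let $p\ge2$ and set \[ \lambda_p=\min_{x\in[1/2,1]}\{x^p+(1-x)^{p-1}(x+p-1)\}. \] Then $\lambda_p\in[2^{-p},p\,2^{1-p}]$, and $\lambda_2=1$. For every $\alpha\ge0$, $\theta\in\mathbb R$, $R>0$ and $u\in C_c^\infty(B^d_R\setminus\{0\})$, \[ \int_{B^d_R}\frac{|\nabla_{\mathcal L}u|^p}{d^{p(\theta-1)}}|\nabla_{\mathcal L}d|^\alpha dx\ \ge\ \int_{B^d_R}\Big|\nabla_{\mathcal L}u\cdot\frac{\nabla_{\mathcal L}d}{|\nabla_{\mathcal L}d|}\Big|^p\frac{|\nabla_{\mathcal L}d|^\alpha}{d^{p(\theta-1)}}dx \] \[ \ge\Big|\frac{Q-p\theta}{p}\Big|^p\int_{B^d_R}\frac{|u|^p}{d^{p\theta}}|\nabla_{\mathcal L}d|^{\alpha+p}dx+\lambda_p\frac{\nu_1(p,p)^p}{R^p}\int_{B^d_R}\frac{|u|^p}{d^{p(\theta-1)}}|\nabla_{\mathcal L}d|^{\alpha+p}dx. \]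
   Context: Vector fields and operators. On $\mathbb R^N$ take $h\le N$ vector fields $X_i=\sum_{j=1}^N\sigma_{i,j}\partial_{x_j}$ with $\sigma_{i,j},\partial_{x_j}\sigma_{i,j}\in C(\mathbb R^N)$. Let $\sigma=(\sigma_{i,j})$ and $\nabla_{\mathcal L}=(X_1,\dots,X_h)=\sigma\nabla$. Set $\operatorname{div}_{\mathcal L}Z=\operatorname{div}(\sigma^TZ)$ and $\mathcal L_pu=\operatorname{div}_{\mathcal L}(|\nabla_{\mathcal L}u|^{p-2}\nabla_{\mathcal L}u)$. Dilations. There are dilations $\delta_\lambda(x)=(\lambda^{\beta_1}x_1,\dots,\lambda^{\beta_N}x_N)$, $\beta_j>0$, with each $X_i$ homogeneous of degree one: $X_i(f\circ\delta_\lambda)=\lambda(X_if)\circ\delta_\lambda$. Set $Q=\sum_j\beta_j$. The function $d$. $d:\mathbb R^N\to[0,\infty)$ satisfies: (i) $d\in C(\mathbb R^N)\cap C^\infty(\mathbb R^N\setminus\{0\})$; (ii) $d(x)=0$ iff $x=0$; (iii) $d(\delta_\lambda x)=\lambda d(x)$; (iv) for every $p\ge2$, $\mathcal L_p(d^{(p-Q)/(p-1)})=0$ in $\mathbb R^N\setminus\{0\}$ if $p\neq Q$, and $\mathcal L_Q(-\ln d)=0$ there if $p=Q$. Balls. $B^d_R=\{d\le R\}$. The number $\nu_1(p,p)$. $\nu_1(p,p)$ is the smallest positive zero of the unique $C^1[0,\infty)$ solution $\varphi$, with $r^{p-1}\phi_p(\varphi')\in C^1[0,\infty)$, of $(r^{p-1}\phi_p(\varphi'))'+r^{p-1}\phi_p(\varphi)=0$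 on $[0,\infty)$, $\varphi(0)=1$, $\varphi'(0)=0$. Here $\phi_p(t)=|t|^{p-2}t$, and $\varphi$ is known to be oscillatory. *)

(* Defs.v *)
From HB Require Import structures.
From mathcomp Require Import all_boot all_order all_algebra.
From mathcomp Require Import all_classical all_reals all_analysis.
Set Implicit Arguments. Unset Strict Implicit. Unset Printing Implicit Defensive.
Import Order.TTheory GRing.Theory Num.Theory.
Import numFieldNormedType.Exports.
Local Open Scope classical_set_scope.
Local Open Scope ring_scope.

Section Defs.
Context {R : realType}.

Definition evec (N : nat) (j : 'I_N) : 'rV[R]_N := delta_mx 0 j.

Definition partial (N : nat) (j : 'I_N) (f : 'rV[R]_N -> R) (x : 'rV[R]_N) : R :=
  'D_(evec j) f x.

Definition dpartials (N : nat) (js : seq 'I_N) (f : 'rV[R]_N -> R) : 'rV[R]_N -> R :=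
  foldr (fun j g => partial j g) f js.

Definition smooth_on (N : nat) (U : set 'rV[R]_N) (f : 'rV[R]_N -> R) : Prop :=
  forall (js : seq 'I_N) (x : 'rV[R]_N), U x -> differentiable (dpartials js f) x.

Definition support_of (N : nat) (f : 'rV[R]_N -> R) : set 'rV[R]_N :=
  closure [set x | f x != 0].

Definition Cc_infty (N : nat) (U : set 'rV[R]_N) (f : 'rV[R]_N -> R) : Prop :=
  smooth_on setT f /\ compact (support_of f) /\ support_of f `<=` U.

Definition enorm (h : nat) (v : 'rV[R]_h) : R := Num.sqrt (\sum_(i < h) v 0 i ^+ 2).
Definition edot (h : nat) (v w : 'rV[R]_h) : R := \sum_(i < h) v 0 i * w 0 i.

Definition Xop (h N : nat) (sigma : 'I_h -> 'I_N -> 'rV[R]_N -> R) (i : 'I_h)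
  (f : 'rV[R]_N -> R) (x : 'rV[R]_N) : R :=
  \sum_(j < N) sigma i j x * partial j f x.

Definition gradL (h N : nat) (sigma : 'I_h -> 'I_N -> 'rV[R]_N -> R)
  (f : 'rV[R]_N -> R) (x : 'rV[R]_N) : 'rV[R]_h :=
  \row_i Xop sigma i f x.

Definition dil (N : nat) (beta : 'I_N -> R) (lam : R) (x : 'rV[R]_N) : 'rV[R]_N :=
  \row_j (powR lam (beta j) * x 0 j).

(** Lebesgue integral over R^N, realised as the iterated one-dimensional
    Lebesgue integral  int dx_N ... int dx_1 f(x_1,...,x_N). *)
Definition set_coord (N : nat) (x : 'rV[R]_N) (k : nat) (t : R) : 'rV[R]_N :=
  \row_j (if (j : nat) == k then t else x 0 j).

Fixpoint iint (N : nat) (k : nat) (f : 'rV[R]_N -> \bar R) : 'rV[R]_N -> \bar R :=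
  match k with
  | 0 => f
  | k'.+1 => fun x =>
      (\int[@lebesgue_measure R]_(t in [set: R]) iint k' f (set_coord x k' t))%E
  end.

Definition intRN (N : nat) (f : 'rV[R]_N -> \bar R) : \bar R := iint N f 0.

Definition intRN_on (N : nat) (A : set 'rV[R]_N) (f : 'rV[R]_N -> R) : \bar R :=
  intRN (fun x => (\1_A x * f x)%:E).

Definition Lp_harmonic_weak (h N : nat) (sigma : 'I_h -> 'I_N -> 'rV[R]_N -> R)
  (p : R) (U : set 'rV[R]_N) (w : 'rV[R]_N -> R) : Prop :=
  forall phi : 'rV[R]_N -> R, Cc_infty U phi ->
    intRN (fun x => (powR (enorm (gradL sigma w x)) (p - 2) *
                     edot (gradL sigma w x) (gradL sigma phi x))%:E) = 0%E.

Definition phip (p t : R) : R := powR `|t| (p - 2) * t.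

Definition C1_nonneg (f f' : R -> R) : Prop :=
  (forall r : R, 0 < r -> is_derive r 1 f (f' r)) /\
  ((fun s : R => s^-1 * (f s - f 0)) @ (0:R)^'+ --> f' 0) /\
  {within `[0, +oo[, continuous f'}.

Definition nu_ode_sol (p : R) (phi : R -> R) : Prop :=
  exists phi' psi' : R -> R,
    C1_nonneg phi phi' /\
    C1_nonneg (fun r => powR r (p - 1) * phip p (phi' r)) psi' /\
    (forall r, 0 <= r -> psi' r + powR r (p - 1) * phip p (phi r) = 0) /\
    phi 0 = 1 /\ phi' 0 = 0.

Definition first_pos_zero (phi : R -> R) (nu : R) : Prop :=
  0 < nu /\ phi nu = 0 /\ (forall r, 0 < r -> r < nu -> phi r != 0).

Definition lam_fun (p x : R) : R := powR x p + powR (1 - x) (p - 1) * (x + p - 1).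
Definition lambda_p (p : R) : R := inf [set lam_fun p x | x in `[2^-1, 1]].

End Defs.

Definition homdim (R : realType) (N : nat) (beta : 'I_N -> R) : R := \sum_(j < N) beta j.

Definition dball (R : realType) (N : nat) (d : 'rV[R]_N -> R) (r : R) : set 'rV[R]_N :=
  [set x | d x <= r].

(* Main.v *)
Require Import Defs.
From HB Require Import structures.
From mathcomp Require Import all_boot all_order all_algebra.
From mathcomp Require Import all_classical all_reals all_analysis.
From mathcomp Require Import measurable_realfun ring lra.
Import Order.TTheory GRing.Theory Num.Theory.
Import numFieldNormedType.Exports.
Local Open Scope classical_set_scope.
Local Open Scope ring_scope.

(** Harmonicity of d^((q-Q)/(q-1)) (of -ln d if q = Q) says that the field
    d^(1-Q) |grad d|^(q-2) grad d is divergence free away from 0, so for q = alpha + p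
    its pairing with the gradient of |u|^p G(d) integrates to 0 for every C^1 function G;
    only smooth test functions are available, and |u|^p G(d) is reached by approximating
    t |-> |t|^p and G in C^1 by polynomials. With kap = (Q - p theta)/p the choice
    G(r) = r^(p kap) (- phip kap + lambda_p phip(r psi'(r) / psi(r))), where
    psi(r) = phi(mu r) and mu r0 < nu, makes the inequality hold pointwise up to this
    null term: write u = d^(- kap) v, expand |grad u| by
    |b - a|^p >= |a|^p - p phip(a) b + lambda_p |b|^p, and bound |grad v|^p from below by
    Young's inequality and the Riccati equation for psi'/psi. Finally mu tends to
    nu / r0, which is needed because the support of u may touch d = r0. *)

(** All integrals are iterated ones, so additivity is not free: it is established for continuous
    functions supported in a fixed compact set, a class that survives integrating out a coordinate.
    The middle integrand, irregular where grad d vanishes, lies outside this class and is never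
    split; the null term is added to the smaller side, and the two sides are then compared
    pointwise.

    The multiplier is read off from exponents and linear terms. Since
    [d^(1-Q) d^(p kap) = d^(1 - p theta)], the null term carries the weight of the right-hand side.
    With S = d <grad u, grad d> / |grad d|^2 and V = S + kap u, the expansion of |V - kap u|^p and
    Young's inequality for |V|^p leave terms linear in V, with total coefficient
    [p phip(u) (- phip kap + lambda_p phip m)]. The derivative of [d^(p kap)] completes S to V. By
    the Riccati equation r times the derivative of [phip m] is [- (p - 1) |m|^p], which is the loss
    in Young's inequality, plus [- mu^p r^p], which is the source of the second integral. *)

Set Implicit Arguments.
Unset Strict Implicit.
Unset Printing Implicit Defensive.

(** * Iterated integrals *)

Section Iterated.
Context {R : realType}.
Notation mu := (@lebesgue_measure R).

(* No measurability is required: for alpha = 0 the integrand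
   |<grad u, grad d> / |grad d||^p jumps where grad d vanishes. *)
Lemma le_integral_any (f g : R -> \bar R) : (forall t, f t <= g t)%E ->
  (\int[mu]_(t in [set: R]) f t <= \int[mu]_(t in [set: R]) g t)%E.
Proof.
move=> fg; rewrite integralE [leRHS]integralE.
have le0 (u v : R -> \bar R) : (forall t, 0 <= u t)%E -> (forall t, 0 <= v t)%E ->
    (forall t, u t <= v t)%E ->
    (\int[mu]_(t in [set: R]) u t <= \int[mu]_(t in [set: R]) v t)%E.
  (* The integral of a nonnegative function is a supremum over the simple functions below it, so it
     grows with the function whether or not that function is measurable. *)
  move=> u0 v0 uv; rewrite !ge0_integralTE//.
  apply: ereal_sup_le => _ [h /= hf <-]; exists h => // t.
  exact: le_trans (hf t) (uv t).
apply: leeB; apply: le0 => // t.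
- by rewrite !funeposE ge_max !le_max fg lexx orbT.
- by rewrite !funenegE ge_max !le_max leeN2 fg lexx orbT.
Qed.

Context {N : nat}.
Implicit Types (f g : 'rV[R]_N -> R) (x y : 'rV[R]_N).

Lemma le_iint k (f g : 'rV[R]_N -> \bar R) : (forall x, f x <= g x)%E ->
  forall x, (iint k f x <= iint k g x)%E.
Proof. by move=> fg; elim: k => //= k IH x; exact: le_integral_any. Qed.

Lemma coord_le_norm x (j : 'I_N) : `|x 0 j| <= `|x|.
Proof.
rewrite [leRHS]mx_normrE.
exact: (le_bigmax _ (fun ij : 'I_1 * 'I_N => `|x ij.1 ij.2|) (0, j)).
Qed.

Lemma norm_le_coord x e : 0 <= e -> (forall j, `|x 0 j| <= e) -> `|x| <= e.
Proof.
move=> e0 xe; rewrite [leLHS]mx_normrE; apply: bigmax_le => // -[i j] _ /=.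
by rewrite ord1.
Qed.

(** Domination by [C] times the indicator of [[- M, M]] gives both the integrability and the
    bound. *)
Lemma slice_int (h : R -> R) (M C : R) : 0 <= M -> continuous h ->
  (forall t, `|h t| <= C) -> (forall t, M < `|t| -> h t = 0) ->
  mu.-integrable setT (EFin \o h) /\ `|Rintegral mu setT h| <= 2 * M * C.
Proof.
move=> M0 hc hC hM.
pose D := `[- M, M]%classic : set R.
have mD : measurable D by exact: measurable_itv.
have muD : mu D = (2 * M)%:E.
  rewrite /D lebesgue_measure_itv/= lte_fin; case: ifPn => [_|].
    by rewrite -?EFinN -?EFinD; congr EFin; rewrite opprK; ring.
  by rewrite -leNgt => MM; congr EFin; lra.
pose b t : R := C * \1_D t.
have ib : mu.-integrable setT (EFin \o b).
  have -> : EFin \o b = (fun t => C%:E * (\1_D t)%:E)%E by apply/funext => t /=; rewrite EFinM.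
  apply: integrableZl => //; apply/integrableP; split.
    by apply/measurable_EFinP; exact: measurable_indic.
  under eq_integral do rewrite gee0_abs ?lee_fin ?indic_ge0//.
  by rewrite integral_indic// setIT [X in (X < _)%E]muD ltry.
have hb t : `|h t| <= b t.
  rewrite /b indicE; case: (boolP (t \in D)) => [_|tD]; first by rewrite mulr1.
  rewrite mulr0 hM ?normr0// ltNge; apply: contra tD => tM.
  by rewrite inE /D/= in_itv/= -ler_norml.
have mh : measurable_fun setT h by apply: measurable_realfun.continuous_measurable_fun.
have ih : mu.-integrable setT (EFin \o h).
  apply: (le_integrable _ _ _ ib) => //; first exact/measurable_EFinP.
  move=> t _ /=; rewrite lee_fin (le_trans (hb t))// ler_norm//.
split => //; apply: le_trans (le_normr_Rintegral _ ih) _ => //.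
have -> : 2 * M * C = \int[mu]_(t in setT) b t.
  rewrite /b RintegralZl//.
    rewrite /Rintegral integral_indic// setIT [X in fine X]muD /= mulrC//.
  apply/integrableP; split.
    by apply/measurable_EFinP; exact: measurable_indic.
  under eq_integral do rewrite gee0_abs ?lee_fin ?indic_ge0//.
  by rewrite integral_indic// setIT [X in (X < _)%E]muD ltry.
apply: le_Rintegral => //.
have -> : EFin \o (fun t => `|h t|) = abse \o (EFin \o h) by apply/funext.
exact: integrable_abse.
Qed.

(* The invariant under which one integration in the k-th coordinate preserves
   continuity, so that the iterated integral never leaves continuous functions. *)
Definition slab k (M C : R) f := [/\ forall e, 0 < e -> exists2 dl, 0 < dl &
      forall x y, `|x - y| < dl -> `|f x - f y| <= e,
    forall x, `|f x| <= C &
    forall x (j : 'I_N), (k <= j)%N -> M < `|x 0 j| -> f x = 0].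

Lemma set_coord_same x k t (j : 'I_N) : j = k :> nat -> set_coord x k t 0 j = t.
Proof. by move=> jk; rewrite mxE jk eqxx. Qed.

Lemma set_coordB x y k t s (e : R) : 0 <= e -> `|t - s| <= e -> `|x - y| <= e ->
  `|set_coord x k t - set_coord y k s| <= e.
Proof.
move=> e0 ts xy; apply: norm_le_coord => // j; rewrite !mxE.
case: ifP => // _; apply: le_trans xy.
by apply: le_trans (coord_le_norm _ j); rewrite !mxE.
Qed.

Lemma slab_slice k M C f x : (k < N)%N -> 0 <= M -> slab k M C f ->
  [/\ continuous (fun t => f (set_coord x k t)),
    mu.-integrable setT (EFin \o (fun t => f (set_coord x k t))) &
    `|Rintegral mu setT (fun t => f (set_coord x k t))| <= 2 * M * C].
Proof.
move=> kN M0 [fc fC fM].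
have hc : continuous (fun t => f (set_coord x k t)).
  move=> t; apply/cvgrPdist_le => e /fc[dl dl0 H].
  apply/nbhs_normP; exists (dl / 2) => /=; first by rewrite divr_gt0.
  move=> s /= ts; apply: H; apply: le_lt_trans (_ : dl / 2 < dl); last by lra.
  by apply: set_coordB; [lra|exact: ltW|rewrite subrr normr0; lra].
have [] := @slice_int _ M C M0 hc; first by move=> t.
  by move=> t tM; apply: (fM _ (Ordinal kN)) => //; rewrite set_coord_same.
by move=> ih ie; split.
Qed.

Lemma slabZ k M C (a : R) f : slab k M C f -> slab k M (`|a| * C) (fun x => a * f x).
Proof.
move=> [fc fC fM]; split.
- move=> e e0; have a1 : 0 < `|a| + 1 by rewrite ltr_pwDr.
  have [|d1 d10 H1] := fc (e / (`|a| + 1)); first by rewrite divr_gt0.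
  exists d1 => // x y /H1 h; rewrite -mulrBr normrM.
  apply: le_trans (_ : (`|a| + 1) * (e / (`|a| + 1)) <= e).
    by apply: ler_pM => //; rewrite lerDl.
  by rewrite mulrC divfK ?gt_eqF.
- by move=> x; rewrite normrM ler_wpM2l.
- by move=> x j kj h; rewrite (fM _ _ kj h) mulr0.
Qed.

Fixpoint rint k f : 'rV[R]_N -> R := match k with
  | 0 => f
  | k'.+1 => fun x => Rintegral mu setT (fun t => rint k' f (set_coord x k' t))
  end.

(** The difference of two slices is uniformly small and vanishes off [[- M, M]], so [slice_int]
    controls its integral; dividing by [2 * M + 1] covers [M = 0]. Coordinate [k] leaves the support
    condition because [set_coord] overwrites it: the integral no longer depends on it. *)
Lemma slab_step k M C f : (k < N)%N -> 0 <= M -> slab k M C f ->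
  slab k.+1 M (2 * M * C) (fun x => Rintegral mu setT (fun t => f (set_coord x k t))).
Proof.
move=> kN M0 sf; have [fc fC fM] := sf; split.
- move=> e e0.
  have [|dl dl0 H] := fc (e / (2 * M + 1)); first by rewrite divr_gt0//; lra.
  exists dl => // x y xy.
  have [cx ix _] := slab_slice x kN M0 sf.
  have [cy iy _] := slab_slice y kN M0 sf.
  rewrite -RintegralB//.
  have [] := @slice_int (fun t => f (set_coord x k t) - f (set_coord y k t)) M
    (e / (2 * M + 1)) M0.
  + by move=> t; apply: cvgB; [exact: cx|exact: cy].
  + move=> t; apply: H; apply: le_lt_trans xy.
    by apply: set_coordB => //; rewrite subrr normr0.
  + move=> t tM; rewrite !(fM _ (Ordinal kN)) ?set_coord_same//; exact: subrr.
  move=> _ h; apply: (le_trans h).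
  rewrite mulrCA -[leRHS]mulr1 ler_pM2l// ler_pdivrMr; lra.
- by move=> x; have [] := slab_slice x kN M0 sf.
- move=> x j kj jM; rewrite (_ : (fun _ => _) = cst 0) ?Rintegral_cst ?mul0r//.
  apply/funext => t; apply: (fM _ j) => //; first exact: ltnW.
  by rewrite mxE gtn_eqF.
Qed.

Lemma slab_rint k M C f : (k <= N)%N -> 0 <= M -> slab 0 M C f ->
  slab k M ((2 * M) ^+ k * C) (rint k f).
Proof.
move=> kN M0 sf; elim: k kN => [_|k IH kN]; first by rewrite expr0 mul1r.
by rewrite exprS -mulrA; apply: slab_step => //; apply: IH; exact: ltnW.
Qed.

(** Each slice is integrable, so the [fine] hidden in [Rintegral] loses nothing at any stage. *)
Lemma iintE k M C f : (k <= N)%N -> 0 <= M -> slab 0 M C f ->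
  iint k (EFin \o f) = EFin \o rint k f.
Proof.
move=> kN M0 sf; elim: k kN => [//|k IH kN]; apply/funext => x /=.
rewrite IH ?(ltnW kN)//.
have [_ ih _] := slab_slice x kN M0 (slab_rint (ltnW kN) M0 sf).
by rewrite /Rintegral fineK//; exact: integrable_fin_num ih.
Qed.

Lemma rint_lin k M C M' C' (a : R) f g : (k <= N)%N -> 0 <= M -> 0 <= M' ->
  slab 0 M C f -> slab 0 M' C' g ->
  rint k (fun x => a * f x + g x) = fun x => a * rint k f x + rint k g x.
Proof.
move=> kN M0 M'0 sf sg; elim: k kN => [//|k IH kN]; apply/funext => x /=.
rewrite IH ?(ltnW kN)//.
have [_ ih _] := slab_slice x kN M0 (slabZ a (slab_rint (ltnW kN) M0 sf)).
have [_ ih' _] := slab_slice x kN M0 (slab_rint (ltnW kN) M0 sf).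
have [_ ig _] := slab_slice x kN M'0 (slab_rint (ltnW kN) M'0 sg).
by rewrite RintegralD// RintegralZl.
Qed.

End Iterated.

(** * Continuous functions with compact support *)

Section Compactness.
Context {R : realType} {V : normedModType R}.
Implicit Types (f : V -> R) (K : set V).

Lemma bounded_on_compact K f : compact K -> (forall x, K x -> {for x, continuous f}) ->
  exists2 C, 0 <= C & forall x, K x -> `|f x| <= C.
Proof.
move=> cK fK.
have : near_covering K by apply/compact_near_coveringP.
move=> /(_ R (pinfty_nbhs R) (fun C x => `|f x| <= C) _) H.
have := H _; case.
  move=> x /fK fx; near=> y C => /=.
  have : `|f x - f y| <= 1 by near: y; move/cvgrPdist_le : fx; exact.
  have : `|f x| + 1 <= C by near: C; exact: nbhs_pinfty_ge.
  move=> h1 h2; have := ler_normB (f x) (f x - f y).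
  by rewrite opprB addrC subrK => /le_trans; apply; apply: le_trans h1; rewrite lerD2l.
move=> C [_ /= CH]; exists (Num.max C 0 + 1).
  by rewrite addr_ge0// le_max lexx orbT.
by move=> x Kx; apply: (CH _ _ x Kx); rewrite ltr_pwDr// le_max lexx.
Unshelve. all: by end_near. Qed.

(** Heine-Cantor with [y] free to leave [K], which is possible because continuity is ambient and not
    relative to [K]. This handles pairs that straddle the boundary of a support. *)
Lemma uniform_on_compact K f e : compact K -> (forall x, K x -> {for x, continuous f}) ->
  0 < e -> exists2 dl, 0 < dl &
    forall x, K x -> forall y, `|x - y| < dl -> `|f x - f y| <= e.
Proof.
move=> cK fK e0.
have : near_covering K by apply/compact_near_coveringP.
move=> /(_ R (0^'+) (fun dl x => forall y, `|x - y| < dl -> `|f x - f y| <= e) _) H.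
have [|dl [] dl0 Hdl] := @filter_ex _ (0 : R)^'+ _ (fun dl : R => 0 < dl /\ forall x, K x -> forall y, `|x - y| < dl -> `|f x - f y| <= e).
  apply: filterI; first exact: nbhs_right_gt.
  apply: H => x Kx.
  have /nbhs_ballP[r /= r0 Hr] : \forall z \near x, `|f x - f z| <= e / 2.
    by move/cvgrPdist_le: (fK x Kx); apply; rewrite divr_gt0.
  near=> z dl => /= y zy.
  have xz : ball x (r / 2) z by near: z; apply: nbhsx_ballx; rewrite divr_gt0.
  have dr : dl < r / 2 by near: dl; apply: nbhs_right_lt; rewrite divr_gt0.
  have zy' : ball z (r / 2) y by rewrite -ball_normE /=; apply: lt_trans dr.
  have h1 : `|f x - f z| <= e / 2.
    by apply: Hr; apply: le_ball xz; rewrite ler_pdivrMr// ler_pMr// ler1n.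
  have h2 : `|f x - f y| <= e / 2 by apply: Hr; exact: ball_split xz zy'.
  rewrite (le_trans (ler_distD (f x) _ _))// [X in X + _]distrC; lra.
by exists dl.
Unshelve. all: by end_near. Qed.

End Compactness.

Section CompactSupport.
Context {R : realType} {N : nat}.
Implicit Types (f g : 'rV[R]_N -> R) (K : set 'rV[R]_N).

(** Continuity is demanded only on [K]: in the application [d] is positive and smooth there, while
    it may be singular at the origin. Off a compact [K] continuity follows from vanishing on an open
    set. *)
Definition supported_continuous K f :=
  (forall x, K x -> {for x, continuous f}) /\ (forall x, ~ K x -> f x = 0).

Lemma supported_continuous_at K f : compact K -> supported_continuous K f ->
  continuous f.
Proof.
move=> cK [fK f0] x; have [/fK//|nKx] := pselect (K x).
have oK : open (~` K) by rewrite openC; exact: compact_closed (@norm_hausdorff _ _) cK.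
apply: (@near_cst_continuous _ _ 0).
have /(@open_nbhs_nbhs _ x) : open_nbhs x (~` K) by [].
by apply: filterS => y /f0.
Qed.

(** [M] depends on [K] alone, so one box serves all functions of an approximation and the constant
    of [integral_c_bound] is independent of [f]. *)
Lemma supported_continuous_slab K : compact K -> exists2 M : R, 0 <= M &
  forall f C, supported_continuous K f -> (forall x, `|f x| <= C) -> slab 0 M C f.
Proof.
move=> cK; have [M M0 KM] := @bounded_on_compact R _ K (fun x => `|x|) cK
  (fun x _ => @norm_continuous _ _ x).
exists M => // f C fsc fC; have fc := supported_continuous_at cK fsc.
have [fK f0] := fsc.
split => //; last first.
  move=> x j _ xM; apply: f0 => /KM; rewrite normr_id => /le_lt_trans - /(_ _ xM).
  by rewrite ltNge coord_le_norm.
move=> e e0.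
have [dl dl0 Hdl] := uniform_on_compact cK fK e0.
exists dl => // x y xy; have [Kx|nKx] := pselect (K x); first exact: Hdl.
have [Ky|nKy] := pselect (K y); first by rewrite distrC; apply: Hdl => //; rewrite distrC.
by rewrite !f0// subrr normr0 ltW.
Qed.

Definition integral_c f : R := rint N f 0.

Lemma supported_continuous_bounded K f : compact K -> supported_continuous K f ->
  exists C, forall x, `|f x| <= C.
Proof.
move=> cK [fK f0]; have [C C0 HC] := bounded_on_compact cK fK.
exists C => x; have [/HC//|nKx] := pselect (K x).
by rewrite f0// normr0.
Qed.

Lemma intRNE K f : compact K -> supported_continuous K f ->
  intRN (EFin \o f) = (integral_c f)%:E.
Proof.
move=> cK fK; have [M M0 H] := supported_continuous_slab cK.
have [C fC] := supported_continuous_bounded cK fK.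
by rewrite /intRN (iintE (leqnn N) M0 (H f C fK fC)).
Qed.

Lemma integral_c_lin K a f g : compact K -> supported_continuous K f ->
  supported_continuous K g ->
  integral_c (fun x => a * f x + g x) = a * integral_c f + integral_c g.
Proof.
move=> cK fK gK; have [M M0 H] := supported_continuous_slab cK.
have [C fC] := supported_continuous_bounded cK fK.
have [D gD] := supported_continuous_bounded cK gK.
by rewrite /integral_c (rint_lin a (leqnn N) M0 M0 (H f C fK fC) (H g D gK gD)).
Qed.

Lemma integral_c_bound K : compact K -> exists2 L : R, 0 <= L &
  forall f C, supported_continuous K f -> (forall x, `|f x| <= C) ->
    `|integral_c f| <= L * C.
Proof.
move=> cK; have [M M0 H] := supported_continuous_slab cK.
exists ((2 * M) ^+ N); first by rewrite exprn_ge0// mulr_ge0.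
move=> f C fK fC.
by have [_ + _] := slab_rint (leqnn N) M0 (H f C fK fC); apply.
Qed.

Lemma supported_continuousM K f g :
  (forall x, K x -> {for x, continuous f}) -> supported_continuous K g ->
  supported_continuous K (fun x => f x * g x).
Proof.
move=> fc [gc g0]; split => [x Kx|x /g0 ->]; last by rewrite mulr0.
exact: (cvgM (fc x Kx) (gc x Kx)).
Qed.

Lemma supported_continuousD K f g : supported_continuous K f ->
  supported_continuous K g -> supported_continuous K (fun x => f x + g x).
Proof.
move=> [fc f0] [gc g0]; split => [x Kx|x Kx]; last by rewrite f0// g0// addr0.
exact: (cvgD (fc x Kx) (gc x Kx)).
Qed.

End CompactSupport.

(** * Polynomial approximation in C^1 *)

Section Weierstrass.
Context {R : realType}.
Implicit Types (f g h : nat -> R) (x : R).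

(* sum_i g(i) C(n,i) X^i (1-X)^(n-i) in de Casteljau form, so that its moments follow
   by induction on n. *)
Fixpoint bernstein n g : {poly R} := match n with
  | 0 => (g 0%N)%:P
  | n'.+1 => 'X * bernstein n' (g \o S) + (1 - 'X) * bernstein n' g
  end.

Lemma bernsteinS n g x : (bernstein n.+1 g).[x] =
  x * (bernstein n (g \o S)).[x] + (1 - x) * (bernstein n g).[x].
Proof. by rewrite /= !hornerE. Qed.

Lemma bernstein_lin n a g h x : (bernstein n (fun i => a * g i + h i)).[x] =
  a * (bernstein n g).[x] + (bernstein n h).[x].
Proof.
elim: n g h => [|n IH] g h; first by rewrite /= !hornerE.
by rewrite !bernsteinS IH (IH (g \o S) (h \o S)); ring.
Qed.

Lemma bernstein_cst n a x : (bernstein n (fun=> a)).[x] = a.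
Proof.
elim: n => [|n IH]; first by rewrite /= !hornerE.
have aS : (fun=> a) \o S = (fun=> a) :> (nat -> R) by [].
by rewrite bernsteinS aS IH; ring.
Qed.

Lemma bernstein_ge0 n g x : 0 <= x <= 1 -> (forall i, (i <= n)%N -> 0 <= g i) ->
  0 <= (bernstein n g).[x].
Proof.
move=> /andP[x0 x1]; elim: n g => [|n IH] g g0; first by rewrite /= hornerE g0.
rewrite bernsteinS addr_ge0// mulr_ge0 ?subr_ge0// IH// => i ni; apply: g0 => //.
exact: ltnW.
Qed.

(** The second moment of the binomial law about an arbitrary centre: the induction needs every [a],
    since the shift by [S] replaces [a] by [a - 1]. *)
Lemma bernstein_variance n a x :
  (bernstein n (fun i => (i%:R - a) ^+ 2)).[x] = n%:R * (x * (1 - x)) + (n%:R * x - a) ^+ 2.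
Proof.
elim: n a => [|n IH] a; first by rewrite /= !hornerE; ring.
rewrite bernsteinS IH.
have -> : (fun i => (i%:R - a) ^+ 2) \o S = (fun i : nat => (i%:R - (a - 1)) ^+ 2).
  by apply/funext => i /=; rewrite -natr1; congr (_ ^+ 2); ring.
by rewrite IH -natr1; ring.
Qed.

Lemma weierstrass01 (f : R -> R) e : (forall x, 0 <= x <= 1 -> {for x, continuous f}) ->
  0 < e -> exists P : {poly R}, forall x, 0 <= x <= 1 -> `|f x - P.[x]| <= e.
Proof.
move=> fc e0; pose K := `[0, 1]%classic : set R.
have cK : compact K by exact: segment_compact.
have fK x : K x -> {for x, continuous f} by rewrite /K /= in_itv; exact: fc.
have e20 : 0 < e / 2 by rewrite divr_gt0.
have [dl dl0 Hdl] := uniform_on_compact cK fK e20.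
have [M M0 HM] := bounded_on_compact cK fK.
(* With this [c] the term [c * (y - x) ^+ 2] is at least [2 * M] once [|x - y| >= dl], so a single
   quadratic bound on [|f x - f y|] holds for all pairs and can be fed to the variance. *)
pose c := 2 * M / dl ^+ 2.
have c0 : 0 <= c by apply: divr_ge0; [apply: mulr_ge0|apply: sqr_ge0].
have fxy x y : K x -> K y -> `|f x - f y| <= e / 2 + c * (y - x) ^+ 2.
  move=> Kx Ky; have [xy|xy] := ltP `|x - y| dl.
    by rewrite (le_trans (Hdl _ Kx _ xy))// lerDl mulr_ge0// sqr_ge0.
  rewrite (le_trans (ler_normB _ _))// -[leLHS]add0r lerD ?(ltW e20)//.
  apply: (le_trans (lerD (HM _ Kx) (HM _ Ky))).
  rewrite /c mulrAC ler_pdivlMr ?exprn_gt0// (_ : M + M = 2 * M); last by ring.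
  rewrite ler_wpM2l ?mulr_ge0//.
  by rewrite -[leRHS]real_normK ?num_real// distrC lerXn2r ?nnegrE// ltW.
have [n /= cn] : exists n : nat, c / (e / 2) < n.+1%:R.
  exists (Num.truncn (c / (e / 2))); exact: truncnS_gt.
have n0 : 0 < n.+1%:R :> R by rewrite ltr0n.
exists (bernstein n.+1 (fun i => f (i%:R / n.+1%:R))) => x x01.
have lin t : (bernstein n.+1 (fun i => t * f x + - t * f (i%:R / n.+1%:R))).[x] =
    t * (f x - (bernstein n.+1 (fun i => f (i%:R / n.+1%:R))).[x]).
  have -> : (fun i : nat => t * f x + - t * f (i%:R / n.+1%:R)) =
     (fun i => - t * f (i%:R / n.+1%:R) + t * f x) by apply/funext => i; rewrite addrC.
  by rewrite (bernstein_lin _ _ _ (fun=> t * f x)) bernstein_cst; ring.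
have bnd : (bernstein n.+1 (fun i => c / n.+1%:R ^+ 2 * (i%:R - n.+1%:R * x) ^+ 2 + e / 2)).[x] <= e.
  rewrite (bernstein_lin _ _ _ (fun=> e / 2)) bernstein_cst bernstein_variance subrr expr0n addr0.
  rewrite [leRHS]splitr lerD2r.
  have -> : c / n.+1%:R ^+ 2 * (n.+1%:R * (x * (1 - x))) = c * (x * (1 - x)) / n.+1%:R.
    by field; rewrite gt_eqF.
  rewrite ler_pdivrMr// (le_trans (_ : _ <= c))//.
    by rewrite ler_piMr//; case/andP: x01 => *; nra.
  by rewrite mulrC -ler_pdivrMr// ltW.
rewrite -[X in `|X|]mul1r -lin.
(* Positivity of [bernstein] compares signed quantities only; [t = 1] and [t = -1] together restore
   the absolute value. *)
have key t : `|t| <= 1 -> t * (f x - (bernstein n.+1 (fun i => f (i%:R / n.+1%:R))).[x]) <= e.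
  move=> t1; apply: le_trans bnd; rewrite -lin -subr_ge0.
  set u := (fun i => t * f x + _); set v := (fun i => _ + e / 2).
  have -> : (bernstein n.+1 v).[x] - (bernstein n.+1 u).[x] = (bernstein n.+1 (fun i => -1 * u i + v i)).[x].
    by rewrite (bernstein_lin _ (-1) u v); ring.
  apply: bernstein_ge0 => // i ni; rewrite mulN1r addrC subr_ge0 /u /v mulNr -mulrBr.
  apply: le_trans (ler_norm _) _; rewrite normrM.
  apply: le_trans (_ : `|f x - f (i%:R / n.+1%:R)| <= _); first by rewrite ler_piMl.
  have Ki : K (i%:R / n.+1%:R).
    by rewrite /K /= in_itv /= divr_ge0//= ler_pdivrMr// mul1r ler_nat.
  have Kx : K x by rewrite /K /= in_itv.
  apply: (le_trans (fxy _ _ Kx Ki)); rewrite addrC lerD2r.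
  by rewrite le_eqVlt; apply/orP; left; apply/eqP; field; rewrite gt_eqF.
rewrite lin mul1r ler_norml.
have := key 1; rewrite normr1 lexx => /(_ isT).
have := key (-1); rewrite normrN1 lexx => /(_ isT).
by rewrite mulN1r mul1r lerNl => -> ->.
Qed.

Lemma weierstrass a b (f : R -> R) e : a < b ->
  (forall x, a <= x <= b -> {for x, continuous f}) ->
  0 < e -> exists P : {poly R}, forall x, a <= x <= b -> `|f x - P.[x]| <= e.
Proof.
move=> ab fc e0; have ba : 0 < b - a by rewrite subr_gt0.
have [|P HP] := @weierstrass01 (fun t => f (a + (b - a) * t)) e _ e0.
  move=> t /andP[t0 t1].
  have h : {for t, continuous (fun t => a + (b - a) * t)}.
    by apply: cvgD; [exact: cvg_cst|apply: cvgM; [exact: cvg_cst|exact: cvg_id]].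
  apply: (continuous_comp h); apply: fc; apply/andP; split; first by rewrite lerDl mulr_ge0// ltW.
  have : (b - a) * t <= b - a by rewrite ger_pMr.
  by rewrite -lerBrDl.
exists (P \Po ((b - a)^-1 *: ('X - a%:P))) => x /andP[ax xb].
rewrite horner_comp !hornerE.
have := HP ((b - a)^-1 * (x - a)); rewrite mulVKf ?gt_eqF// subrKC; apply.
rewrite mulrC divr_ge0 ?subr_ge0 ?(ltW ab)//= ler_pdivrMr// mul1r.
by rewrite lerD2r.
Qed.

Definition antideriv (P : {poly R}) : {poly R} := \poly_(i < (size P).+1) (P`_i.-1 / i%:R).

Lemma deriv_antideriv P : (antideriv P)^`() = P.
Proof.
apply/polyP => i; rewrite coef_deriv coef_poly ltnS.
have [iP|Pi] := ltnP i (size P); last by rewrite nth_default// mul0rn.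
by rewrite /= -[_ *+ _]mulr_natr divfK// pnatr_eq0.
Qed.

Lemma is_derive_horner (P : {poly R}) x : is_derive x 1 (horner P) P^`().[x].
Proof.
have dP := @derivable_horner _ P x.
by apply: DeriveDef => //; rewrite derivE derive1E.
Qed.

(** Approximate [f'] and take the antiderivative that agrees with [f] at [c]; by the mean value
    theorem the tolerance [e / (1 + (b - a))] on [f'] serves for both. Exactness at [c] is used with
    [c = 0], where [P.[0] = 0] keeps the support of [P(u)] inside that of [u]. *)
Lemma weierstrass_C1 a b c (f f' : R -> R) e : a < b -> a <= c <= b ->
  (forall x, a <= x <= b -> is_derive x 1 f (f' x)) ->
  (forall x, a <= x <= b -> {for x, continuous f'}) -> 0 < e ->
  exists P : {poly R}, P.[c] = f c /\ forall x, a <= x <= b ->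
    `|f x - P.[x]| <= e /\ `|f' x - P^`().[x]| <= e.
Proof.
move=> ab acb fd fc e0; have ba : 0 < b - a by rewrite subr_gt0.
have e'0 : 0 < e / (1 + (b - a)) by rewrite divr_gt0// addr_gt0.
have [P0 HP0] := weierstrass ab fc e'0.
pose P := antideriv P0 + (f c - (antideriv P0).[c])%:P.
have dP : P^`() = P0 by rewrite derivD deriv_antideriv derivC addr0.
have Pc : P.[c] = f c by rewrite hornerD hornerC addrC subrK.
exists P; split => // x axb.
have ee : e / (1 + (b - a)) <= e.
  have b1 : 0 < 1 + (b - a) by lra.
  by rewrite ler_pdivrMr// mulrDr mulr1 lerDl mulr_ge0// ltW.
split; last by rewrite dP (le_trans (HP0 _ axb)).
pose k := (fun x => f x - P.[x]).
have kd y : a <= y <= b -> is_derive y 1 k (f' y - P0.[y]).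
  move=> /fd fy; have hy := is_derive_horner P y; rewrite dP in hy.
  exact: is_deriveB.
have kcont y z : a <= y -> z <= b -> {within `[y, z], continuous k}.
  move=> ay zb; apply: derivable_within_continuous => w; rewrite in_itv /= => /andP[yw wz].
  have aw : a <= w <= b by rewrite (le_trans ay)//= (le_trans wz).
  by have [] := kd _ aw.
have main y z : a <= y -> y <= z -> z <= b -> `|k z - k y| <= e.
  move=> ay yz zb.
  have [||w wyz ->] := @MVT_segment _ k (fun y => f' y - P0.[y]) y z yz; last 2 first.
  - exact: kcont.
  - move: wyz; rewrite in_itv /= => /andP[yw wz].
    have awb : a <= w <= b by rewrite (le_trans ay)//= (le_trans wz).
    rewrite normrM; apply: le_trans (_ : e / (1 + (b - a)) * (1 + (b - a)) <= e); last first.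
      by rewrite divfK// gt_eqF// addr_gt0.
    apply: ler_pM => //; first exact: HP0.
    rewrite ger0_norm ?subr_ge0//; lra.
  - move=> w; rewrite in_itv /= => /andP[yw wz]; apply: kd.
    by rewrite (le_trans ay (ltW yw))/= (le_trans (ltW wz)).
have kc : k c = 0 by rewrite /k Pc subrr.
have -> : f x - P.[x] = k x - k c by rewrite kc subr0.
case/andP: axb => ax xb; case/andP: acb => ac cb.
have [cx|xc] := leP c x; first exact: main.
by rewrite distrC; apply: main => //; exact: ltW.
Qed.

End Weierstrass.

(** * The elementary inequality behind lambda_p *)

Section Powers.
Context {R : realType}.
Implicit Types (p q t x y a b : R).

Lemma powR_norm_at a t : 0 <= a \/ t != 0 -> {for t, continuous (fun s : R => powR `|s| a)}.
Proof.
move=> h; have [t0|t0] := eqVneq t 0; last first.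
  have nt0 : 0 < `|t| by rewrite normr_gt0.
  apply: (@continuous_comp _ _ _ (fun s : R => `|s|) (fun s => powR s a)).
    exact: norm_continuous.
  apply/differentiable_continuous/derivable1_diffP.
  by apply: derivable_powR; rewrite in_itv /= andbT.
case: h => [|/eqP//]; rewrite le_eqVlt => /predU1P[<-|a0].
  have -> : (fun s : R => powR `|s| 0) = cst 1 by apply/funext => s; rewrite powRr0.
  exact: cst_continuous.
rewrite t0; apply/cvgrPdist_le => e e0 /=.
rewrite normr0 powR0 ?gt_eqF//.
have ea : 0 < e `^ a^-1 by rewrite powR_gt0.
have near0 : \forall s \near (0 : R), `|s| <= e `^ a^-1 by exact: nbhs0_le.
apply: filterS near0 => s sa; rewrite sub0r normrN ger0_norm ?powR_ge0//.
have := @ge0_ler_powR _ a (ltW a0) _ _ _ _ sa.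
rewrite !nnegrE normr_ge0 ltW// => /(_ isT isT) /le_trans; apply.
by rewrite -powRrM mulVf ?gt_eqF// powRr1// ltW.
Qed.

Lemma phip_continuous p : 2 <= p -> continuous (phip p).
Proof.
move=> p2 t; apply: cvgM; last exact: cvg_id.
by apply: powR_norm_at; left; rewrite subr_ge0.
Qed.

Lemma powR_sub2 p t : 0 < t -> t `^ (p - 2) = t `^ p / t ^+ 2.
Proof. by move=> t0; rewrite powRB ?(gt_eqF t0) ?implybT// -powR_mulrn ?ltW. Qed.

Lemma powR_sub1 p t : 0 < t -> t `^ (p - 1) = t `^ p / t.
Proof. by move=> t0; rewrite powRB ?(gt_eqF t0) ?implybT// powRr1 ?ltW. Qed.

Lemma phip0 p : phip p 0 = 0. Proof. by rewrite /phip mulr0. Qed.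

Lemma phipN p t : phip p (- t) = - phip p t.
Proof. by rewrite /phip normrN mulrN. Qed.

Lemma phipM p x y : phip p (x * y) = phip p x * phip p y.
Proof. by rewrite /phip normrM powRM// mulrACA. Qed.

Lemma phip_mul p t : 2 <= p -> phip p t * t = `|t| `^ p.
Proof.
move=> p2; have [->|t0] := eqVneq t 0; first by rewrite mulr0 normr0 powR0// gt_eqF//; lra.
rewrite /phip -mulrA -expr2 -(real_normK (num_real t)) powR_sub2 ?normr_gt0// divfK//.
by rewrite expf_neq0// normr_eq0.
Qed.

Lemma phip_ge0E p t : 2 <= p -> 0 <= t -> phip p t = t `^ (p - 1).
Proof.
move=> p2; rewrite le_eqVlt => /predU1P[<-|t0].
  by rewrite phip0 powR0// gt_eqF//; lra.
by rewrite /phip gtr0_norm// powR_sub2// powR_sub1//; field; rewrite gt_eqF.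
Qed.

Lemma norm_phip p t : 2 <= p -> `|phip p t| = `|t| `^ (p - 1).
Proof.
move=> p2; rewrite -phip_ge0E// /phip normrM !normr_id.
by rewrite ger0_norm ?powR_ge0.
Qed.

Lemma is_derive_powR_norm p t : 2 <= p ->
  is_derive t 1 (fun s : R => `|s| `^ p) (p * phip p t).
Proof.
move=> p2.
have pos (s : R) : 0 < s -> is_derive s 1 (fun s : R => `|s| `^ p) (p * phip p s).
  move=> s0; rewrite phip_ge0E// ?ltW//.
  have h : is_derive s 1 (fun s => s `^ p) (p * s `^ (p - 1)) by exact: is_derive1_powR.
  have e : {near s, (fun s => s `^ p) =1 (fun s : R => `|s| `^ p)}.
    by apply: filterS (lt_nbhsr s0) => z z0; rewrite gtr0_norm.
  exact: near_eq_is_derive e h.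
have [t0|t0|->] := ltgtP t 0; first 1 last.
- exact: pos.
(* At 0 the slope function is [phip p] itself, because [phip p z * z = |z|^p]. *)
- rewrite phip0 mulr0; apply/is_derive1_caratheodory; exists (phip p); split.
  + by move=> z; rewrite normr0 powR0 ?subr0 ?phip_mul// gt_eqF//; lra.
  + exact: phip_continuous.
  + exact: phip0.
- have -> : (fun s : R => `|s| `^ p) = (fun s : R => `|s| `^ p) \o -%R.
    by apply/funext => s /=; rewrite normrN.
  have -> : p * phip p t = p * phip p (- t) * (- 1) by rewrite phipN; ring.
  apply: is_derive1_comp; first by apply: pos; rewrite oppr_gt0.
Qed.

(** Young's inequality for [y] and [x^(q-1)] with exponents [q] and [q / (q - 1)]. The case [q = 1],
    which has no finite conjugate exponent, is kept because the lemma is applied at [q = p - 1] with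
    [p = 2] allowed. *)
Lemma young q x y : 1 <= q -> 0 <= x -> 0 <= y ->
  q * x `^ (q - 1) * y <= y `^ q + (q - 1) * x `^ q.
Proof.
move=> q1 x0 y0; move: q1; rewrite le_eqVlt => /predU1P[<-|q1].
  by rewrite subrr powRr0 mul0r addr0 mul1r powRr1// mul1r.
have [x00|xn0] := eqVneq x 0.
  by rewrite x00 !powR0 ?gt_eqF ?mulr0 ?mul0r ?addr0 ?powR_ge0//; lra.
have q0 : 0 < q by lra.
have := @conjugate_powR R y (x `^ (q - 1)) q (q / (q - 1)) y0 (powR_ge0 _ _) q0.
have -> : 0 < q / (q - 1) by rewrite divr_gt0//; lra.
move=> /(_ isT); have -> : q^-1 + (q / (q - 1))^-1 = 1.
  by field; rewrite !gt_eqF//; lra.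
move=> /(_ erefl); rewrite -powRrM.
have -> : (q - 1) * (q / (q - 1)) = q by field; rewrite gt_eqF//; lra.
rewrite -(ler_pM2l q0) => /le_trans-/(_ _ _).
have -> : q * (y * x `^ (q - 1)) = q * x `^ (q - 1) * y by ring.
apply; rewrite le_eqVlt; apply/orP; left; apply/eqP.
by field; rewrite !gt_eqF//; lra.
Qed.

(** The left side is the tangent at [m] of the convex function [|.|^p], evaluated at [V]. *)
Lemma young_phip p m V : 2 <= p ->
  p * phip p m * V - (p - 1) * `|m| `^ p <= `|V| `^ p.
Proof.
move=> p2; have := @young p `|m| `|V| _ (normr_ge0 _) (normr_ge0 _).
have -> : 1 <= p by lra.
move=> /(_ isT); rewrite -norm_phip// => h.
have : phip p m * V <= `|phip p m| * `|V| by rewrite -normrM ler_norm.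
nra.
Qed.

Lemma lam_fun_ge p x : 2 <= p -> 2^-1 <= x <= 1 -> 2 `^ (- p) <= lam_fun p x.
Proof.
move=> p2 /andP[x1 x2]; rewrite /lam_fun.
have h : 2 `^ (- p) <= x `^ p.
  rewrite powRN -[leLHS]mul1r -ler_pdivlMr ?invr_gt0 ?powR_gt0// invrK -powRM//; last lra.
  apply: (@le_trans _ _ (1 `^ p)); first by rewrite powR1.
  by rewrite ge0_ler_powR ?nnegrE//; lra.
apply: (le_trans h); rewrite lerDl mulr_ge0 ?powR_ge0//; lra.
Qed.

Lemma lambda_p_le p x : 2 <= p -> 2^-1 <= x <= 1 -> lambda_p p <= lam_fun p x.
Proof.
move=> p2 x12; apply: ge_inf; last by exists x => //=; rewrite in_itv.
exists (2 `^ (- p)) => _ [y /= + <-]; rewrite in_itv /=; exact: lam_fun_ge.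
Qed.

Lemma lambda_p_ge p : 2 <= p -> 2 `^ (- p) <= lambda_p p.
Proof.
move=> p2; apply: lb_le_inf; first by exists (lam_fun p 1), 1; rewrite //= in_itv /=; lra.
move=> _ [y /= + <-]; rewrite in_itv /=; exact: lam_fun_ge.
Qed.

(** The bound is the value of [lam_fun p] at the endpoint 1/2. *)
Lemma lambda_p_upper p : 2 <= p -> lambda_p p <= p * 2 `^ (1 - p).
Proof.
move=> p2; have h2 : (2^-1 : R) <= (2^-1 : R) <= 1 by rewrite lexx /=; lra.
apply: (le_trans (lambda_p_le p2 h2)).
rewrite /lam_fun (_ : 1 - 2^-1 = 2^-1 :> R); last by field.
have h : (2^-1 : R) `^ p = 2 `^ (- p) by rewrite -powR_inv1// -powRrM mulN1r.
rewrite powR_sub1 ?h; last lra.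
have -> : 2 `^ (1 - p) = 2 * 2 `^ (- p) :> R.
  by rewrite powRD ?powRr1 ?pnatr_eq0 ?implybT.
by rewrite le_eqVlt; apply/orP; left; apply/eqP; field.
Qed.

Lemma lambda_2 : lambda_p (2 : R) = 1.
Proof.
have E (y : R) : 2^-1 <= y <= 1 -> lam_fun 2 y = 1.
  move=> /andP[y1 y2]; rewrite /lam_fun powR_mulrn; last lra.
  by rewrite (_ : 2 - 1 = 1 :> R) ?powRr1; [ring|lra|ring].
apply/eqP; rewrite eq_le; apply/andP; split.
  have h1 : (2^-1 : R) <= (1 : R) <= (1 : R) by apply/andP; split; lra.
  by have := lambda_p_le (lexx 2) h1; rewrite E.
apply: lb_le_inf; first by exists (lam_fun 2 1), 1; rewrite //= in_itv /=; lra.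
by move=> _ [y /= + <-]; rewrite in_itv /= => /E ->.
Qed.


(** The coefficient that [|b|^p] may carry in [norm_sub_powR_ge], after division by [|b|^p] and with
    [a] for the quotient of the two arguments. *)
Definition gap p a := `|1 - a| `^ p - `|a| `^ p + p * phip p a.

Lemma gap_lam_fun p a : 2 <= p -> 0 <= a <= 1 -> gap p a = lam_fun p (1 - a).
Proof.
move=> p2 /andP[a0 a1]; rewrite /gap /lam_fun opprB addrCA subrr addr0.
rewrite -phip_ge0E// -phip_mul// (ger0_norm (_ : 0 <= 1 - a)) ?subr_ge0//; ring.
Qed.

Lemma is_derive_phip p t : 2 <= p -> 0 < t ->
  is_derive t 1 (phip p) ((p - 1) * t `^ (p - 2)).
Proof.
move=> p2 t0.
have h : is_derive t 1 (fun s => s `^ (p - 1)) ((p - 1) * t `^ (p - 2)).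
  by have := is_derive1_powR (p - 1) t0; rewrite -addrA -opprD.
have e : {near t, (fun s => s `^ (p - 1)) =1 phip p}.
  by apply: filterS (lt_nbhsr t0) => z z0; rewrite phip_ge0E// ltW.
exact: near_eq_is_derive e h.
Qed.

Lemma ndecr_of_derive (f f' : R -> R) a : continuous f ->
  (forall x, a < x -> is_derive x 1 f (f' x)) -> (forall x, a < x -> 0 <= f' x) ->
  forall x, a <= x -> f a <= f x.
Proof.
move=> fc fd f0 x ax; apply: (@ger0_derive1_ndecry R f a) => //.
- by move=> y; rewrite in_itv /= andbT => /fd[].
- move=> y; rewrite in_itv /= andbT => ay; have := fd _ ay => hd.
  by rewrite derive1E derive_val f0.
- exact: continuous_subspaceT.
Qed.

Lemma powR_norm_continuous p : 2 <= p -> continuous (fun s : R => `|s| `^ p).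
Proof. by move=> p2 t; apply: powR_norm_at; left; lra. Qed.

Lemma gap_continuous p : 2 <= p -> continuous (gap p).
Proof.
move=> p2 t; apply: cvgD; last first.
  by apply: cvgM; [exact: cvg_cst|exact: phip_continuous].
apply: cvgB; last exact: powR_norm_continuous.
apply: (@continuous_comp _ _ _ (fun s : R => 1 - s) (fun s => `|s| `^ p)).
  by apply: cvgB; [exact: cvg_cst|exact: cvg_id].
exact: powR_norm_continuous.
Qed.

(** The derivative is nonnegative for two reasons. On (1/2, 1], [(1 - x)^(p-2) <= x^(p-2)] gives
    [phip x + phip (1 - x) <= x^(p-2)]. Beyond 1, convexity of [t^(p-1)] bounds
    [x^(p-1) - (x - 1)^(p-1)] by the slope at [x], which is [young] with exponent [p - 1]. *)
Lemma gap_ge_half p a : 2 <= p -> 2^-1 <= a -> gap p 2^-1 <= gap p a.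
Proof.
move=> p2 ha; pose f' x := p * ((p - 1) * x `^ (p - 2) - phip p x - phip p (1 - x)).
apply: (@ndecr_of_derive (gap p) f' 2^-1) => // [||x hx]; first exact: gap_continuous.
  move=> x hx; have x0 : 0 < x by apply: lt_trans hx; rewrite invr_gt0.
  have h1 := is_derive_powR_norm x p2.
  have h2 : is_derive x 1 ((fun s : R => `|s| `^ p) \o (fun s => 1 - s)) (p * phip p (1 - x) * (0 - 1)).
    apply: is_derive1_comp; first exact: is_derive_powR_norm.
  have h3 : is_derive x 1 (p \*: phip p) (p *: ((p - 1) * x `^ (p - 2))).
    by apply: is_deriveZ; exact: is_derive_phip.
  have h := is_deriveD (is_deriveB h2 h1) h3.
  apply: is_derive_eq h _; rewrite /f' /GRing.scale /=; ring.
have x0 : 0 < x by apply: lt_trans hx; rewrite invr_gt0.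
rewrite /f' mulr_ge0 ?subr_ge0//; first lra.
have [x1|x1] := leP x 1.
  have -> : phip p (1 - x) = (1 - x) `^ (p - 2) * (1 - x).
    by rewrite /phip ger0_norm ?subr_ge0.
  have -> : phip p x = x `^ (p - 2) * x by rewrite /phip gtr0_norm.
  have : (1 - x) `^ (p - 2) <= x `^ (p - 2) by apply: ge0_ler_powR; rewrite ?nnegrE; lra.
  have := powR_ge0 x (p - 2); move: (x `^ _) ((1 - x) `^ _) => A B A0 BA.
  have : B * (1 - x) <= A * (1 - x) by rewrite ler_wpM2r// subr_ge0.
  have : 0 <= (p - 2) * A by rewrite mulr_ge0 ?subr_ge0.
  lra.
rewrite -opprB phipN !phip_ge0E//; [|lra|lra].
have := @young (p - 1) x (x - 1) _ (ltW x0) _.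
rewrite (_ : 1 <= p - 1); last lra.
rewrite (_ : 0 <= x - 1); last lra.
move=> /(_ isT isT); rewrite (_ : p - 1 - 1 = p - 2); last ring.
have -> : x `^ (p - 1) = x `^ (p - 2) * x by rewrite powR_sub2// powR_sub1//; field; rewrite gt_eqF.
nra.
Qed.

(** After the reflection [x = - a], the derivative is [p] times the excess of [(1 + x)^(p-1)] over
    the tangent of [t^(p-1)] at [x], again nonnegative by [young] with exponent [p - 1]. *)
Lemma gap_ge_neg p a : 2 <= p -> a <= 0 -> gap p 0 <= gap p a.
Proof.
move=> p2 ha; pose f' x := p * (phip p (1 + x) - phip p x - (p - 1) * x `^ (p - 2)).
pose f x := gap p (- x).
have -> : gap p 0 = f 0 by rewrite /f oppr0.
have -> : gap p a = f (- a) by rewrite /f opprK.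
apply: (@ndecr_of_derive f f' 0); last by rewrite oppr_ge0.
- move=> t; apply: (@continuous_comp _ _ _ -%R (gap p)); last exact: gap_continuous.
  exact: opp_continuous.
- move=> x x0; have h1 := is_derive_powR_norm x p2.
  have h2 : is_derive x 1 ((fun s : R => `|s| `^ p) \o (fun s => 1 + s)) (p * phip p (1 + x) * (0 + 1)).
    apply: is_derive1_comp; first exact: is_derive_powR_norm.
  have h3 : is_derive x 1 (p \*: phip p) (p *: ((p - 1) * x `^ (p - 2))).
    by apply: is_deriveZ; exact: is_derive_phip.
  have -> : f = ((fun s : R => `|s| `^ p) \o (fun s => 1 + s)) - (fun s : R => `|s| `^ p) - (p \*: phip p).
    by apply/funext => s; rewrite /f /gap !fctE /= phipN normrN opprK mulrN.
  have h := is_deriveB (is_deriveB h2 h1) h3.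
  apply: is_derive_eq h _; rewrite /f' /GRing.scale /=; ring.
move=> x x0; rewrite /f' mulr_ge0 ?subr_ge0//; first lra.
rewrite !phip_ge0E//; [|lra|lra].
have := @young (p - 1) x (1 + x) _ (ltW x0) _.
rewrite (_ : 1 <= p - 1); last lra.
rewrite (_ : 0 <= 1 + x); last lra.
move=> /(_ isT isT); rewrite (_ : p - 1 - 1 = p - 2); last ring.
have -> : x `^ (p - 1) = x `^ (p - 2) * x by rewrite powR_sub2// powR_sub1//; field; rewrite gt_eqF.
nra.
Qed.

(** On [0, 1/2] the gap is [lam_fun p (1 - a)] with [1 - a] in [1/2, 1]; outside, it is at least its
    value at the nearer endpoint. This is why the minimum defining [lambda_p] runs over [1/2, 1]
    only. *)
Lemma lambda_p_le_gap p a : 2 <= p -> lambda_p p <= gap p a.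
Proof.
move=> p2.
have small b : 0 <= b <= 2^-1 -> lambda_p p <= gap p b.
  move=> /andP[b0 b1]; rewrite gap_lam_fun//; last lra.
  by apply: lambda_p_le => //; lra.
have [a0|a0] := leP a 0.
  by apply: le_trans (gap_ge_neg p2 a0); apply: small; lra.
have [a1|a1] := leP a 2^-1; first by apply: small; lra.
by apply: le_trans (gap_ge_half p2 (ltW a1)); apply: small; lra.
Qed.

Lemma norm_sub_powR_ge p a b : 2 <= p ->
  `|a| `^ p - p * phip p a * b + lambda_p p * `|b| `^ p <= `|b - a| `^ p.
Proof.
move=> p2; have [->|b0] := eqVneq b 0.
  by rewrite normr0 powR0 ?sub0r ?normrN ?mulr0 ?subr0 ?addr0// gt_eqF//; lra.
have := lambda_p_le_gap (a / b) p2; rewrite /gap.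
have bp : 0 < `|b| `^ p by rewrite powR_gt0// normr_gt0.
have e1 : `|1 - a / b| `^ p * `|b| `^ p = `|b - a| `^ p.
  by rewrite -powRM// -normrM mulrBl mul1r divfK.
have e2 : `|a / b| `^ p * `|b| `^ p = `|a| `^ p by rewrite -powRM// -normrM divfK.
have E (A B C w : R) : (A - B + C) * w = A * w - B * w + C * w by ring.
rewrite -(ler_pM2r bp) E e1 e2.
have -> : p * phip p (a / b) * `|b| `^ p = p * phip p a * b.
  by rewrite -(phip_mul b p2) -mulrA [phip p (a / b) * _]mulrA -phipM divfK// mulrA.
lra.
Qed.

End Powers.

(** * The one-dimensional multiplier *)

Section OneDim.
Context {R : realType}.
Implicit Types (p r mu nu : R) (phi : R -> R).

Lemma within_itv_continuous_at (f : R -> R) r : {within `[0, +oo[, continuous f} ->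
  0 < r -> {for r, continuous f}.
Proof.
move=> fc r0; have fo : {within `]0, +oo[, continuous f}.
  apply: continuous_subspaceW fc => x /=; rewrite !in_itv /= !andbT; exact: ltW.
have := fo; rewrite continuous_open_subspace; last exact: interval_open.
by apply; rewrite inE /= in_itv /= r0.
Qed.

Lemma is_derive_continuous (f : R -> R) r df : is_derive r 1 f df -> {for r, continuous f}.
Proof. by move=> [fd _]; apply/differentiable_continuous/derivable1_diffP. Qed.

(** The right difference quotient at 0 tends to 0, so [|phi s - 1| <= s < 1] at some small [s > 0];
    a negative value before [nu] would then produce a zero between. Starting at [s] rather than 0
    avoids the values of [phi] on the negative axis, about which nothing is known. *)
Lemma ode_sol_gt0 p phi nu : nu_ode_sol p phi -> first_pos_zero phi nu ->
  forall r, 0 < r < nu -> 0 < phi r.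
Proof.
move=> [phi' [psi' [[dphi [phi0 _]] [_ [_ [phi00 phi'0]]]]]] [nu0 [_ nz]] r /andP[r0 rnu].
rewrite lt0r nz//= leNgt; apply/negP => phir.
have [s [s0 sr phis]] : exists s, [/\ 0 < s, s < r & 0 < phi s].
  rewrite phi'0 phi00 in phi0.
  have near1 : \forall s \near (0:R)^'+, `|0 - s^-1 * (phi s - 1)| <= 1.
    by move/cvgrPdist_le: phi0; apply.
  have near2 : \forall s \near (0:R)^'+, s < Num.min r 1.
    by apply: nbhs_right_lt; rewrite lt_min r0 ltr01.
  have near3 : \forall s \near (0:R)^'+, 0 < s by exact: nbhs_right_gt.
  have [s [[]]] := filter_ex (filterI (filterI near1 near2) near3).
  rewrite sub0r normrN lt_min => h /andP[sr s1] s0; exists s; split => //.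
  have : `|phi s - 1| <= s.
    move: h; rewrite normrM normfV (gtr0_norm s0) mulrC ler_pdivrMr// mul1r//.
  by rewrite ler_norml => /andP[h1 _]; lra.
have phic : {within `[s, r], continuous phi}.
  apply: derivable_within_continuous => x; rewrite in_itv /= => /andP[sx _].
  by have [] := dphi x (lt_le_trans s0 sx).
have [|c] := @IVT R phi s r 0 (ltW sr) phic.
  by rewrite ge_min le_max (ltW phir) orbT (ltW phis).
rewrite in_itv /= => /andP[sc cr] phic0.
have := nz c (lt_le_trans s0 sc) (le_lt_trans cr rnu).
by rewrite phic0 eqxx.
Qed.

Lemma phip1 p : phip p 1 = 1. Proof. by rewrite /phip normr1 powR1 mul1r. Qed.

(* Here m(r) = r psi'(r) / psi(r) with psi(r) = phi(mu r); the last identity is the Riccati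
   equation of psi'/psi. *)
Lemma riccati p phi nu mu r0 : 2 <= p -> nu_ode_sol p phi -> first_pos_zero phi nu ->
  0 < mu -> mu * r0 < nu ->
  exists g g' m : R -> R, forall r, 0 < r <= r0 ->
    [/\ is_derive r 1 g (g' r), {for r, continuous g'}, g r = phip p (m r) &
        r * g' r = - (mu `^ p * r `^ p) - (p - 1) * `|m r| `^ p].
Proof.
move=> p2 sol hnu mu0 mur0.
have pos := ode_sol_gt0 sol hnu.
have [phi' [psi' [[dphi [_ cphi']] [[dY [_ cpsi']] [ode [_ _]]]]]] := sol.
pose Y r := powR r (p - 1) * phip p (phi' r).
(* By multiplicativity this is [phip p (s * phi' s / phi s)]. The quotient form is the
   differentiable one: [phi'] itself need not be differentiable, but [Y] is, by the equation. *)
pose H s := Y s * (phip p (phi s))^-1.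
pose H' s := - s `^ (p - 1) - (p - 1) * Y s * phi' s / phi s `^ p.
exists (fun r => H (mu * r)), (fun r => mu * H' (mu * r)),
  (fun r => mu * r * phi' (mu * r) / phi (mu * r)) => r /andP[rpos rr0].
set s := mu * r; have s0 : 0 < s by rewrite mulr_gt0.
have snu : s < nu by rewrite (le_lt_trans _ mur0)// ler_pM2l.
have phis : 0 < phi s by apply: pos; rewrite s0 snu.
have phipE : phip p (phi s) = phi s `^ p / phi s.
  by rewrite phip_ge0E ?(ltW phis)// powR_sub1.
have phipn0 : phip p (phi s) != 0.
  by rewrite phipE mulf_neq0// ?invr_eq0 gt_eqF// powR_gt0.
have dH : is_derive s 1 H (H' s).
  have d1 := dY s s0.
  have d2 : is_derive s 1 (phip p \o phi) ((p - 1) * phi s `^ (p - 2) * phi' s).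
    by apply: is_derive1_comp; [exact: is_derive_phip|exact: dphi].
  have d3 := is_deriveM d1 (@is_deriveV R (phip p \o phi) s _ 1 phipn0 d2).
  apply: is_derive_eq d3 _.
  have ye : psi' s = - (s `^ (p - 1) * phip p (phi s)).
    by apply/eqP; rewrite -addr_eq0 (ode _ (ltW s0)).
  rewrite ye /= -[powR s (p - 1) * phip p (phi' s)]/(Y s) /H' /GRing.scale /= phipE powR_sub2//.
  field; rewrite !gt_eqF//; exact: powR_gt0.
have dmu : is_derive r 1 (fun r => mu * r) mu.
  have := is_deriveZ mu (is_derive_id r (1 : R)).
  by move=> /(is_derive_eq (df := _)); apply; rewrite /GRing.scale /= mulr1.
have cmu : {for r, continuous (fun r => mu * r)} by exact: is_derive_continuous dmu.
split.
- rewrite mulrC; exact: is_derive1_comp.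
- apply: (@cvgM _ _ _ _ (fun=> mu)); first exact: cvg_cst.
  apply: (@continuous_comp _ _ _ (fun r => mu * r) H') => //.
  have cp : {for s, continuous (fun s => s `^ (p - 1))}.
    exact: is_derive_continuous (is_derive1_powR (p - 1) s0).
  have cphi : {for s, continuous phi} by exact: is_derive_continuous (dphi _ s0).
  have cphip : {for s, continuous (fun s => phi s `^ p)}.
    apply: (@continuous_comp _ _ _ phi (fun s => s `^ p)) => //.
    exact: is_derive_continuous (is_derive1_powR p phis).
  have cY : {for s, continuous Y} by exact: is_derive_continuous (dY _ s0).
  have cf' := within_itv_continuous_at cphi' s0.
  apply: cvgB; first exact: cvgN.
  apply: cvgM; last by apply: cvgV => //; rewrite gt_eqF// powR_gt0.
  by apply: cvgM => //; apply: cvgM => //; exact: cvg_cst.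
- rewrite /H /Y (phipM p (s * phi' s)) (phipM p s).
  have -> : phip p (phi s)^-1 = (phip p (phi s))^-1.
    apply: (mulfI phipn0); rewrite mulfV// -phipM mulfV ?phip1//.
    by rewrite gt_eqF.
  by rewrite (phip_ge0E p2 (ltW s0)).
- have -> : r * (mu * H' s) = s * H' s by rewrite /s; ring.
  rewrite -powRM ?ltW// -/s -phip_mul//.
  have -> : phip p (s * phi' s / phi s) = Y s * (phip p (phi s))^-1.
    rewrite /Y (phipM p (s * phi' s)) (phipM p s); congr (_ * _); first by rewrite (phip_ge0E p2 (ltW s0)).
    apply: (mulfI phipn0); rewrite mulfV// -phipM mulfV ?phip1//.
    by rewrite gt_eqF.
  rewrite /H' phipE -(@mulr_powRB1 _ s p (ltW s0)); last lra.
  field; rewrite !gt_eqF//; exact: powR_gt0.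
Qed.

(** The sum of [norm_sub_powR_ge] for [V - kap * t] and of [lambda_p] times [young_phip] at [m * t];
    the sign of [lambda_p] matters for the second. After substitution of the Riccati identity both
    sides of the bookkeeping agree exactly. *)
Lemma pointwise_scalar p kap t S r mu m dg : 2 <= p ->
  r * dg = - (mu `^ p * r `^ p) - (p - 1) * `|m| `^ p ->
  `|kap| `^ p * `|t| `^ p + lambda_p p * (mu `^ p * r `^ p) * `|t| `^ p
   + (p * phip p t * (- phip p kap + lambda_p p * phip p m) * (S + kap * t)
   + `|t| `^ p * (lambda_p p * (r * dg))) <= `|S| `^ p.
Proof.
move=> p2 ->; set V := S + kap * t.
have := norm_sub_powR_ge (kap * t) V p2; rewrite /V addrK -/V.
rewrite normrM powRM// phipM.
have := young_phip (m * t) V p2; rewrite normrM powRM// phipM.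
have l0 : 0 <= lambda_p p by apply: le_trans (lambda_p_ge p2); exact: powR_ge0.
move/(ler_wpM2l l0).
move: (lambda_p p) (phip p m) (phip p kap) (phip p t) (`|V| `^ p) (`|S| `^ p) (`|kap| `^ p)
  (`|t| `^ p) (`|m| `^ p) (mu `^ p * r `^ p) => L pm pk pt Vp Sp kp tp mp mr; lra.
Qed.

(* Here [r], [n], [e], [t] stand for d, |grad d|, <grad u, grad d> and u at a point, and
   [r^(p kap) k] for the multiplier G(d), whose derivative is [r^(p kap) (p kap k / r + k')]. *)
Lemma pointwise_multiplier p alpha theta Q kap r n e t mu m dg : 2 <= p -> 0 <= alpha ->
  p * kap = Q - p * theta -> 0 < r -> 0 <= n -> (n = 0 -> e = 0) ->
  r * dg = - (mu `^ p * r `^ p) - (p - 1) * `|m| `^ p ->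
  let k := - phip p kap + lambda_p p * phip p m in
  `|kap| `^ p * (`|t| `^ p / r `^ (p * theta) * n `^ (alpha + p)) +
  lambda_p p * mu `^ p * (`|t| `^ p / r `^ (p * (theta - 1)) * n `^ (alpha + p)) +
  r `^ (1 - Q) * n `^ (alpha + p - 2) *
    (p * phip p t * (r `^ (p * kap) * k) * e +
     `|t| `^ p * (r `^ (p * kap) * (p * kap * k / r + lambda_p p * dg)) * n ^+ 2)
  <= `|e / n| `^ p * n `^ alpha / r `^ (p * (theta - 1)).
Proof.
move=> p2 a0 kapE r0 n_ge0 n0e dgE; cbv zeta; set k := _ + lambda_p p * phip p m.
(* Where grad d vanishes, [n^(alpha + p - 2)] can be [0^0 = 1], but the bracket it multiplies is 0
   since [e = 0] and [n ^+ 2 = 0]; the other terms vanish because [alpha + p > 0]. *)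
move: n_ge0 n0e; rewrite le_eqVlt => /predU1P[<- /(_ erefl) ->|n0 _].
  rewrite expr0n /= !mulr0 addr0 (@powR0 _ (alpha + p)) ?gt_eqF//; last lra.
  rewrite !mulr0 !addr0 divr_ge0 ?mulr_ge0 ?powR_ge0//.
(* [S] is the derivative of u along d grad d / |grad d|^2, the radial field normalised to send d to
   d. In these terms [z * W] factors out of the whole inequality and leaves [pointwise_scalar]. *)
pose S := r * e / n ^+ 2; pose W := n `^ (alpha + p); pose z := r `^ (- (p * theta)).
have nn : n != 0 by rewrite gt_eqF.
have rn : r != 0 by rewrite gt_eqF.
have eE : e = S * n ^+ 2 / r by rewrite /S; field; rewrite nn rn.
have W0 : 0 <= W by exact: powR_ge0.
have z0 : 0 <= z by exact: powR_ge0.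
have rp0 : r `^ p != 0 by rewrite gt_eqF// powR_gt0.
have E1 : (r `^ (p * theta))^-1 = z by rewrite /z powRN.
have E2 : (r `^ (p * (theta - 1)))^-1 = z * r `^ p.
  by rewrite -powRN /z -powRD ?rn ?implybT//; congr powR; ring.
have E3 : n `^ (alpha + p - 2) = W / n ^+ 2 by rewrite powR_sub2.
have E4 : r `^ (1 - Q) * r `^ (p * kap) = r * z.
  rewrite -powRD ?rn ?implybT// kapE -{2}(powRr1 (ltW r0)) /z -powRD ?rn ?implybT//.
  by congr powR; ring.
have E5 : `|e / n| `^ p * n `^ alpha = `|S| `^ p * W / r `^ p.
  have -> : e / n = S * (n / r) by rewrite eE; field; rewrite nn rn.
  rewrite normrM powRM// [`|n / r|]gtr0_norm ?divr_gt0// /W powRD ?nn ?implybT//.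
  rewrite powRM ?invr_ge0 ?ltW// -powR_inv1 ?ltW// -powRrM mulN1r powRN.
  by field.
rewrite E5 E2 E1 E3.
have -> : `|S| `^ p * W / r `^ p * (z * r `^ p) = z * W * `|S| `^ p by field.
have := pointwise_scalar kap t S p2 dgE; rewrite -/k => /(ler_wpM2l (mulr_ge0 z0 W0)).
apply: le_trans; rewrite le_eqVlt; apply/orP; left; apply/eqP.
rewrite -(phip_mul t p2) eE.
have -> : r `^ (1 - Q) * (W / n ^+ 2) *
   (p * phip p t * (r `^ (p * kap) * k) * (S * n ^+ 2 / r) +
    phip p t * t * (r `^ (p * kap) * (p * kap * k / r + lambda_p p * dg)) * n ^+ 2) =
   (r `^ (1 - Q) * r `^ (p * kap)) * (W / n ^+ 2) *
   (p * phip p t * k * (S * n ^+ 2 / r) +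
    phip p t * t * (p * kap * k / r + lambda_p p * dg) * n ^+ 2) by ring.
rewrite E4 -/W; field; rewrite nn rn//.
Qed.

End OneDim.

(** * Smooth functions *)

Section Smooth.
Context {R : realType} {N : nat}.
Notation V := ('rV[R]_N).
Implicit Types (f g : V -> R) (U : set V) (x : V).

Lemma near0_differentiable (k : V -> R) x : (\forall y \near x, k y = 0) -> differentiable k x.
Proof.
move=> kx; have k0 : k x = 0 by exact: nbhs_singleton kx.
have kE : k \o shift x = cst (k x) + \0 +o_ (0 : V) id.
  apply/eqaddoP => _/posnumP[e]; have : \forall h \near (0 : V), k (h + x) = 0.
    by have := kx; rewrite (near_shift 0) /= subr0.
  apply: filterS => h /= kh.
  by rewrite !fctE /= k0 kh !addr0 subrr normr0 mulr_ge0.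
have c0 : continuous (0 : V -> R) by exact: cst_continuous.
have dE : 'd k x = 0 :> (V -> R) by apply/diff_unique; [exact: c0|exact: kE].
by apply/diff_locallyP; rewrite dE.
Qed.

Lemma near_eq_differentiable f g x : (\forall y \near x, f y = g y) ->
  differentiable f x -> differentiable g x.
Proof.
move=> fg df; have -> : g = f + (g - f) by rewrite addrC subrK.
apply: differentiableD => //; apply: near0_differentiable.
by apply: filterS fg => y fgy; rewrite !fctE fgy subrr.
Qed.

Lemma eq_dpartials U f g : open U -> (forall x, U x -> f x = g x) ->
  forall js x, U x -> dpartials js f x = dpartials js g x.
Proof.
move=> oU fg; elim => [|j js IH] x Ux; first exact: fg.
rewrite /= /partial; apply: near_eq_derive.
have : nbhs x U by exact: open_nbhs_nbhs.
by apply: filterS => y /IH.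
Qed.

Lemma eq_smooth_on U f g : open U -> (forall x, U x -> f x = g x) ->
  smooth_on U f -> smooth_on U g.
Proof.
move=> oU fg sf js x Ux; apply: near_eq_differentiable (sf js x Ux).
have : nbhs x U by exact: open_nbhs_nbhs.
by apply: filterS => y Uy; exact: (eq_dpartials oU fg).
Qed.

(** Counting derivatives makes induction possible: the product rule turns one derivative of [f * g]
    into products whose factors are smooth to one order less, for arbitrary [f] and [g]. *)
Definition smooth_upto n U f := forall js, (size js <= n)%N -> forall x, U x ->
  differentiable (dpartials js f) x.

Lemma smooth_upto0 n U f x : smooth_upto n U f -> U x -> differentiable f x.
Proof. by move=> sf Ux; exact: (sf [::] _ x Ux). Qed.

Lemma smooth_uptoS n U f : (forall x, U x -> differentiable f x) ->
  (forall j, smooth_upto n U (partial j f)) -> smooth_upto n.+1 U f.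
Proof.
move=> df sf; case/lastP => [|js j]; first by move=> _; exact: df.
by rewrite size_rcons /dpartials foldr_rcons; exact: sf.
Qed.

Lemma smooth_upto_partial n U f j : smooth_upto n.+1 U f -> smooth_upto n U (partial j f).
Proof.
move=> sf js jsn x Ux; have := sf (rcons js j) _ x Ux.
by rewrite size_rcons /dpartials foldr_rcons; exact.
Qed.

Lemma smooth_uptoW n U f : smooth_upto n.+1 U f -> smooth_upto n U f.
Proof. by move=> sf js jsn; apply: sf; exact: ltnW. Qed.

Lemma eq_smooth_upto n U f g : open U -> (forall x, U x -> f x = g x) ->
  smooth_upto n U f -> smooth_upto n U g.
Proof.
move=> oU fg sf js jsn x Ux; apply: near_eq_differentiable (sf js jsn x Ux).
have : nbhs x U by exact: open_nbhs_nbhs.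
by apply: filterS => y Uy; exact: (eq_dpartials oU fg).
Qed.

Lemma smooth_uptoD n U f g : open U -> smooth_upto n U f -> smooth_upto n U g ->
  smooth_upto n U (f + g).
Proof.
move=> oU; elim: n f g => [|n IH] f g sf sg.
  case=> // _ x Ux; apply: differentiableD; [exact: smooth_upto0 sf Ux|exact: smooth_upto0 sg Ux].
apply: smooth_uptoS => [x Ux|j].
  by apply: differentiableD; [exact: smooth_upto0 sf Ux|exact: smooth_upto0 sg Ux].
apply: (@eq_smooth_upto _ _ (partial j f + partial j g)) => //.
  move=> x Ux; rewrite /partial fctE deriveD//; apply: diff_derivable.
  - exact: smooth_upto0 sf Ux.
  - exact: smooth_upto0 sg Ux.
by apply: IH; exact: smooth_upto_partial.
Qed.

Lemma smooth_uptoM n U f g : open U -> smooth_upto n U f -> smooth_upto n U g ->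
  smooth_upto n U (f * g).
Proof.
move=> oU; elim: n f g => [|n IH] f g sf sg.
  case=> // _ x Ux; apply: differentiableM; [exact: smooth_upto0 sf Ux|exact: smooth_upto0 sg Ux].
apply: smooth_uptoS => [x Ux|j].
  by apply: differentiableM; [exact: smooth_upto0 sf Ux|exact: smooth_upto0 sg Ux].
apply: (@eq_smooth_upto _ _ (f * partial j g + g * partial j f)) => //.
  move=> x Ux; rewrite /partial !fctE deriveM//; apply: diff_derivable.
  - exact: smooth_upto0 sf Ux.
  - exact: smooth_upto0 sg Ux.
by apply: smooth_uptoD => //; apply: IH; [exact: smooth_uptoW|
  exact: smooth_upto_partial|exact: smooth_uptoW|exact: smooth_upto_partial].
Qed.

Lemma smooth_onP U f : smooth_on U f <-> forall n, smooth_upto n U f.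
Proof.
split=> [sf n js _ x Ux|sf js x Ux]; first exact: sf.
exact: (sf (size js)).
Qed.

Lemma smooth_onD U f g : open U -> smooth_on U f -> smooth_on U g -> smooth_on U (f + g).
Proof.
by move=> oU /smooth_onP sf /smooth_onP sg; apply/smooth_onP => n; exact: smooth_uptoD.
Qed.

Lemma smooth_onM U f g : open U -> smooth_on U f -> smooth_on U g -> smooth_on U (f * g).
Proof.
by move=> oU /smooth_onP sf /smooth_onP sg; apply/smooth_onP => n; exact: smooth_uptoM.
Qed.

Lemma smooth_on_cst U (a : R) : smooth_on U (cst a).
Proof.
move=> js x _; have [b ->] : exists b, dpartials js (cst a) = cst b :> (V -> R).
  elim: js => [|j js [b /= ->]]; first by exists a.
  by exists 0; apply/funext => y; rewrite /partial derive_cst.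
exact: differentiable_cst.
Qed.

Lemma smooth_on_horner U f (P : {poly R}) : open U -> smooth_on U f ->
  smooth_on U (fun x => P.[f x]).
Proof.
move=> oU sf; elim/poly_ind: P => [|P c IH].
  have -> : (fun x => (0 : {poly R}).[f x]) = cst 0 by apply/funext => x; rewrite horner0.
  exact: smooth_on_cst.
have -> : (fun x => (P * 'X + c%:P).[f x]) = (fun x => P.[f x]) * f + cst c.
  by apply/funext => x; rewrite !hornerE.
by apply: smooth_onD => //; [exact: smooth_onM|exact: smooth_on_cst].
Qed.

Lemma is_derive_partial_comp f (F : R -> R) (dF : R) j x : differentiable f x ->
  is_derive (f x) 1 F dF -> is_derive x (evec j) (F \o f) (dF * partial j f x).
Proof.
move=> df hF; have dFf : differentiable F (f x) by apply/derivable1_diffP; case: hF.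
have dc := differentiable_comp df dFf.
apply: DeriveDef; first exact: diff_derivable.
rewrite deriveE// diff_comp// /= diff1E// derive1E (@derive_val _ _ _ _ _ _ _ hF).
by rewrite /partial deriveE// mulrC.
Qed.

End Smooth.

(** * Euclidean vectors *)

Section Vectors.
Context {R : realType} {h : nat}.
Implicit Types (v w : 'rV[R]_h) (a : R).

Lemma edotZl a v w : edot (a *: v) w = a * edot v w.
Proof. by rewrite /edot mulr_sumr; apply: eq_bigr => i _; rewrite mxE mulrA. Qed.

Lemma edotC v w : edot v w = edot w v.
Proof. by apply: eq_bigr => i _; rewrite mulrC. Qed.

Lemma edotDl v v' w : edot (v + v') w = edot v w + edot v' w.
Proof. by rewrite /edot -big_split; apply: eq_bigr => i _; rewrite mxE mulrDl. Qed.

Lemma edot0l w : edot 0 w = 0.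
Proof. by rewrite /edot big1// => i _; rewrite mxE mul0r. Qed.

Lemma enorm_ge0 v : 0 <= enorm v. Proof. exact: sqrtr_ge0. Qed.

Lemma enorm_sqr v : enorm v ^+ 2 = edot v v.
Proof.
rewrite /enorm sqr_sqrtr; first by apply: eq_bigr => i _; rewrite expr2.
by apply: sumr_ge0 => i _; exact: sqr_ge0.
Qed.

Lemma enormZ a v : enorm (a *: v) = `|a| * enorm v.
Proof.
apply/eqP; rewrite -(eqrXn2 (ltn0Sn 1))// ?mulr_ge0 ?enorm_ge0//.
by rewrite exprMn !enorm_sqr edotZl edotC edotZl real_normK ?num_real// mulrA expr2.
Qed.

Lemma enorm_eq0 v : enorm v = 0 -> v = 0.
Proof.
move=> /(congr1 (fun z => z ^+ 2)); rewrite enorm_sqr expr0n /= => v0.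
apply/rowP => i; rewrite mxE; apply/eqP; rewrite -sqrf_eq0 expr2.
have /psumr_eq0P : forall i, true -> 0 <= v 0 i * v 0 i by move=> *; rewrite -expr2 sqr_ge0.
by move=> /(_ v0 i isT) ->.
Qed.

Lemma cauchy_schwarz v w : `|edot v w| <= enorm v * enorm w.
Proof.
rewrite -(ler_pXn2r (ltn0Sn 1)) ?nnegrE ?mulr_ge0 ?enorm_ge0//.
rewrite real_normK ?num_real// exprMn !enorm_sqr.
have [w0|wn0] := eqVneq (enorm w) 0.
  by rewrite (enorm_eq0 w0) edotC !edot0l expr0n mulr0.
have wp : 0 < edot w w by rewrite -enorm_sqr exprn_gt0// lt0r wn0 enorm_ge0.
pose t := edot v w / edot w w.
have : 0 <= edot (v + - t *: w) (v + - t *: w) by rewrite -enorm_sqr sqr_ge0.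
have -> : edot (v + - t *: w) (v + - t *: w) =
    edot v v - 2 * t * edot v w + t ^+ 2 * edot w w.
  by rewrite edotDl edotZl (edotC v) (edotC w (_ + _)) !edotDl !edotZl (edotC w v); ring.
move/(mulr_ge0 (ltW wp)); rewrite -subr_ge0 => H; apply: (le_trans H).
by rewrite le_eqVlt; apply/orP; left; apply/eqP; rewrite /t; field; rewrite gt_eqF.
Qed.

Lemma norm_edot_div v w : `|edot v w / enorm w| <= enorm v.
Proof.
have [w0|wn0] := eqVneq (enorm w) 0; first by rewrite w0 invr0 mulr0 normr0 enorm_ge0.
have wp : 0 < enorm w by rewrite lt0r wn0 enorm_ge0.
by rewrite normrM normfV (gtr0_norm wp) ler_pdivrMr// cauchy_schwarz.
Qed.

Context {T : topologicalType}.
Implicit Types (f g : T -> 'rV[R]_h).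

Lemma sum_continuous_at n (f : 'I_n -> T -> R) x : (forall i, {for x, continuous (f i)}) ->
  {for x, continuous (fun y => \sum_(i < n) f i y)}.
Proof.
move=> fc; apply: cvg_big; first exact: add_continuous.
by move=> i _; exact: fc.
Qed.

Lemma edot_continuous_at f g x : (forall i, {for x, continuous (fun y => f y 0 i)}) ->
  (forall i, {for x, continuous (fun y => g y 0 i)}) ->
  {for x, continuous (fun y => edot (f y) (g y))}.
Proof. by move=> fc gc; apply: sum_continuous_at => i; apply: cvgM; [exact: fc|exact: gc]. Qed.

Lemma enorm_powR_continuous_at f x (s : R) :
  (forall i, {for x, continuous (fun y => f y 0 i)}) -> 0 <= s ->
  {for x, continuous (fun y => enorm (f y) `^ s)}.
Proof.
move=> fc s0.
have ec : {for x, continuous (fun y => enorm (f y))}.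
  apply: (@continuous_comp _ _ _ (fun y => \sum_(i < h) f y 0 i ^+ 2) Num.sqrt).
    by apply: sum_continuous_at => i; apply: cvgM; exact: fc.
  exact: sqrt_continuous.
have -> : (fun y => enorm (f y) `^ s) = (fun y => `|enorm (f y)| `^ s).
  by apply/funext => y; rewrite ger0_norm ?enorm_ge0.
apply: (@continuous_comp _ _ _ (fun y => enorm (f y)) (fun t => `|t| `^ s)) => //.
by apply: powR_norm_at; left.
Qed.

End Vectors.

Section ContinuousAt.
Context {R : realType} {T : topologicalType}.
Implicit Types (f g : T -> R) (x : T).

Lemma mul_continuous_at f g x : {for x, continuous f} -> {for x, continuous g} ->
  {for x, continuous (fun y => f y * g y)}.
Proof. by move=> fc gc; exact: (cvgM fc gc). Qed.

Lemma add_continuous_at f g x : {for x, continuous f} -> {for x, continuous g} ->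
  {for x, continuous (fun y => f y + g y)}.
Proof. by move=> fc gc; exact: (cvgD fc gc). Qed.

End ContinuousAt.

Lemma eq0_small {R : realType} (x C : R) : (forall e, 0 < e -> `|x| <= e * C) -> x = 0.
Proof.
move=> H; apply/eqP; rewrite -normr_le0 leNgt; apply/negP => x0.
have C1 : 0 < `|C| + 1 by rewrite ltr_pwDr.
have : `|x| <= `|x| / 2 / (`|C| + 1) * C by apply: H; rewrite !divr_gt0.
apply/negP; rewrite -ltNge; apply: (@le_lt_trans _ _ (`|x| / 2)); last lra.
rewrite mulrAC ler_pdivrMr// ler_pM2l ?divr_gt0//.
by have := ler_norm C; lra.
Qed.

(** * The divergence-free field *)

Section Flux.
Context {R : realType} {h N : nat}.
Context (sigma : 'I_h -> 'I_N -> 'rV[R]_N -> R)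
  (Hsig_cont : forall i j, continuous (sigma i j)).
Notation V := 'rV[R]_N.
Implicit Types (f : V -> R) (x : V) (K : set V).

Lemma gradL_continuous_at f x i : (forall j, {for x, continuous (partial j f)}) ->
  {for x, continuous (fun y => gradL sigma f y 0 i)}.
Proof.
move=> fc; have -> : (fun y => gradL sigma f y 0 i) = Xop sigma i f.
  by apply/funext => y; rewrite mxE.
by apply: sum_continuous_at => j; exact: mul_continuous_at (@Hsig_cont i j x) (@fc j).
Qed.

Lemma gradL_scale f g x (a : R) : (forall j, partial j f x = a * partial j g x) ->
  gradL sigma f x = a *: gradL sigma g x.
Proof.
move=> fg; apply/rowP => i; rewrite !mxE /Xop mulr_sumr.
by apply: eq_bigr => j _; rewrite fg mulrCA.
Qed.

Lemma gradL_lin f g k x (a b : R) :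
  (forall j, partial j f x = a * partial j g x + b * partial j k x) ->
  gradL sigma f x = a *: gradL sigma g x + b *: gradL sigma k x.
Proof.
move=> fg; apply/rowP => i; rewrite !mxE /Xop !mulr_sumr -big_split.
by apply: eq_bigr => j _; rewrite fg /=; ring.
Qed.

Lemma partial_near0 f x j : (\forall y \near x, f y = 0) -> partial j f x = 0.
Proof.
move=> f0; rewrite /partial (@near_eq_derive _ _ _ f (cst 0)) ?derive_cst//.
Qed.

Lemma gradL_near0 f x : (\forall y \near x, f y = 0) -> gradL sigma f x = 0.
Proof.
move=> f0; rewrite (@gradL_scale f f x 0) ?scale0r// => j.
by rewrite mul0r partial_near0.
Qed.

Lemma support_near0 f x : ~ support_of f x -> \forall y \near x, f y = 0.
Proof.
move=> nfx; have : open (~` support_of f) by rewrite openC; exact: closed_closure.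
move=> oK; have := open_nbhs_nbhs (conj oK nfx); apply: filterS => y nfy.
apply/eqP/negPn/negP => fy; apply: nfy; exact: subset_closure.
Qed.

Context (d : V -> R) (Hd_cont : continuous d)
  (Hd_smooth : smooth_on [set x | x != 0] d)
  (Hd_nonneg : forall x, 0 <= d x) (Hd_zero : forall x, d x = 0 <-> x = 0).
Context (u : V -> R) (u_smooth : smooth_on setT u).
Notation K := (support_of u).
Context (cK : compact K) (K0 : forall x, K x -> x != 0).

Notation gd := (gradL sigma d).
Notation gu := (gradL sigma u).

Lemma open_neq0 : open [set x : V | x != 0].
Proof.
have -> : [set x : V | x != 0] = ~` [set 0].
  by apply/seteqP; split => y /=; [move=> /eqP|move=> ?; apply/eqP].
rewrite openC; apply: compact_closed; first exact: norm_hausdorff.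
exact: compact_set1.
Qed.

Lemma d_gt0 x : x != 0 -> 0 < d x.
Proof.
by move=> x0; rewrite lt0r Hd_nonneg andbT; apply: contra x0 => /eqP/Hd_zero/eqP.
Qed.

Lemma gd_continuous_at x i : K x -> {for x, continuous (fun y => gd y 0 i)}.
Proof.
move=> /K0 x0; apply: gradL_continuous_at => j; apply: differentiable_continuous.
exact: (Hd_smooth [:: j] x0).
Qed.

Lemma gu_continuous_at x i : {for x, continuous (fun y => gu y 0 i)}.
Proof.
apply: gradL_continuous_at => j; apply: differentiable_continuous.
exact: (u_smooth [:: j]).
Qed.

Lemma u_continuous : continuous u.
Proof. by move=> x; apply: differentiable_continuous; exact: (u_smooth [::]). Qed.

Lemma d_powR_continuous_at x (s : R) : K x -> {for x, continuous (fun y => d y `^ s)}.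
Proof.
move=> /K0/d_gt0 dx; apply: (@continuous_comp _ _ _ d (fun t => t `^ s)) => //.
  exact: Hd_cont.
apply/differentiable_continuous/derivable1_diffP.
by apply: derivable_powR; rewrite in_itv /= andbT.
Qed.

(* The pairing of d^(1-Q) |grad d|^(q-2) grad d with grad (F(u) G(d)); F' and G' stand
   for the derivatives of F and G. *)
Definition flux (q Q : R) (F F' G G' : R -> R) x : R :=
  d x `^ (1 - Q) * enorm (gd x) `^ (q - 2) *
  (F' (u x) * G (d x) * edot (gu x) (gd x) + F (u x) * G' (d x) * enorm (gd x) ^+ 2).

Lemma flux_supported q Q F F' G G' : 2 <= q -> continuous F -> continuous F' -> F 0 = 0 ->
  (forall x, K x -> {for d x, continuous G}) ->
  (forall x, K x -> {for d x, continuous G'}) ->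
  supported_continuous K (flux q Q F F' G G').
Proof.
move=> q2 Fc F'c F0 Gc G'c; split => x Kx; last first.
  have u0 := support_near0 Kx.
  by rewrite /flux (gradL_near0 u0) edot0l (nbhs_singleton u0) F0; ring.
have cF (k : R -> R) : continuous k -> {for x, continuous (fun y => k (u y))}.
  by move=> kc; apply: (@continuous_comp _ _ _ u k); [exact: u_continuous|exact: kc].
have cG (k : R -> R) : {for d x, continuous k} -> {for x, continuous (fun y => k (d y))}.
  by move=> kc; apply: (@continuous_comp _ _ _ d k) => //; exact: Hd_cont.
have cgd i : {for x, continuous (fun y => gd y 0 i)} by exact: gd_continuous_at.
rewrite /flux; apply: mul_continuous_at.
  apply: mul_continuous_at; first exact: d_powR_continuous_at.
  by apply: enorm_powR_continuous_at => //; rewrite subr_ge0.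
apply: add_continuous_at.
  apply: mul_continuous_at; last first.
    by apply: edot_continuous_at; [move=> i; exact: gu_continuous_at|exact: cgd].
  by apply: mul_continuous_at; [exact: cF|apply: cG; exact: Gc].
apply: mul_continuous_at; first by apply: mul_continuous_at; [exact: cF|apply: cG; exact: G'c].
have -> : (fun y => enorm (gd y) ^+ 2) = (fun y => edot (gd y) (gd y)).
  by apply/funext => y; rewrite enorm_sqr.
exact: edot_continuous_at.
Qed.

(** [S(d)] may be singular at the origin, but [P.[0] = 0] makes the product vanish on the complement
    of [K], an open neighbourhood of 0; this set and the punctured space cover everything. *)
Lemma test_function_smooth (P S : {poly R}) : P.[0] = 0 ->
  Cc_infty [set x | x != 0] (fun x => P.[u x] * S.[d x]).
Proof.
move=> P0; set eta := fun x => _.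
have eta0 x : ~ K x -> eta x = 0.
  by move=> /support_near0/nbhs_singleton; rewrite /eta => ->; rewrite P0 mul0r.
have sub : support_of eta `<=` K.
  rewrite {1}/support_of (closure_id K).1; last exact: closed_closure.
  by apply: closure_subset => x /= ex; apply: contrapT => /eta0 e0; rewrite e0 eqxx in ex.
split; last first.
  split; last by move=> x /sub /K0.
  by apply: (subclosed_compact _ cK sub); exact: closed_closure.
have oK : open (~` K) by rewrite openC; exact: closed_closure.
have s1 : smooth_on (~` K) eta.
  by apply: (@eq_smooth_on _ _ _ (cst 0)) => //; [move=> x /eta0|exact: smooth_on_cst].
have s2 : smooth_on [set x | x != 0] eta.
  have -> : eta = (fun x => P.[u x]) * (fun x => S.[d x]) by apply/funext.
  apply: smooth_onM; first exact: open_neq0.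
    by apply: smooth_on_horner; [exact: open_neq0|move=> js x _; exact: u_smooth].
  by apply: smooth_on_horner; [exact: open_neq0|exact: Hd_smooth].
move=> js x _; have [Kx|nKx] := pselect (K x); last exact: s1.
by apply: s2; exact: K0.
Qed.

Lemma integral_cZ (a : R) f : supported_continuous K f ->
  integral_c (fun x => a * f x) = a * integral_c f.
Proof.
move=> fK; have f0 : integral_c (fun x => - 1 * f x + f x) = 0.
  by rewrite (integral_c_lin _ cK fK fK); ring.
have E0 : (fun x => - 1 * f x + f x) = cst 0 by apply/funext => x; rewrite mulN1r addNr.
have c0 : supported_continuous K (cst 0) by split => // x _; exact: cst_continuous.
rewrite E0 in f0; rewrite -[RHS]addr0 -f0 -(integral_c_lin a cK fK c0).
by congr integral_c; apply/funext => x; rewrite addr0.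
Qed.

(** In both cases the harmonic profile has derivative [c * r^b] with [c != 0] and
    [b * (q - 1) = 1 - Q]. Hence its nonlinear gradient field is [phip q c] times the field in
    [flux], and testing with [P(u) S(d)] gives the claim. *)
Lemma flux_poly q Q (P S : {poly R}) :
  (forall q : R, 2 <= q ->
     (q != Q -> Lp_harmonic_weak sigma q [set x | x != 0]
          (fun x => powR (d x) ((q - Q) / (q - 1)))) /\
     (q = Q -> Lp_harmonic_weak sigma q [set x | x != 0] (fun x => - ln (d x)))) ->
  2 <= q -> P.[0] = 0 ->
  integral_c (flux q Q (horner P) (horner P^`()) (horner S) (horner S^`())) = 0.
Proof.
move=> harm q2 P0.
have [f [c [b [c0 bq fd hw]]]] : exists (f : R -> R) (c b : R), [/\ c != 0,
    b * (q - 1) = 1 - Q, forall r : R, 0 < r -> is_derive r 1 f (c * r `^ b) &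
    Lp_harmonic_weak sigma q [set x | x != 0] (f \o d)].
  have [h1 h2] := harm q q2; have q1 : q - 1 != 0 by rewrite gt_eqF//; lra.
  have [qQ|qQ] := eqVneq q Q.
    exists (fun r => - ln r), (-1), (-1); split; [by rewrite oppr_eq0 oner_eq0|by rewrite -qQ; ring| |exact: h2].
    move=> r r0; have hl := is_deriveN (is_derive1_ln r0).
    by apply: is_derive_eq hl _; rewrite powR_inv1 ?ltW// mulN1r.
  exists (fun r => r `^ ((q - Q) / (q - 1))), ((q - Q) / (q - 1)), ((q - Q) / (q - 1) - 1).
  split; [by rewrite mulf_neq0 ?invr_eq0// subr_eq0| by field| |exact: h1].
  by move=> r r0; exact: is_derive1_powR.
have PhiK : supported_continuous K (flux q Q (horner P) (horner P^`()) (horner S) (horner S^`())).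
  by apply: flux_supported => //; try (move=> ? _); exact: continuous_horner.
set Phi := flux _ _ _ _ _ _ in PhiK *.
have PhiE x : Phi x = d x `^ (1 - Q) * enorm (gd x) `^ (q - 2) *
  (P^`().[u x] * S.[d x] * edot (gu x) (gd x) + P.[u x] * S^`().[d x] * enorm (gd x) ^+ 2) by [].
clearbody Phi.
pose eta := fun x => P.[u x] * S.[d x].
have := hw eta (test_function_smooth S P0).
have -> : (fun x => (powR (enorm (gradL sigma (f \o d) x)) (q - 2) *
    edot (gradL sigma (f \o d) x) (gradL sigma eta x))%:E) = EFin \o (fun x => phip q c * Phi x).
  apply/funext => x /=; congr EFin; have [Kx|nKx] := pselect (K x); last first.
    have eta0 : \forall y \near x, eta y = 0.
      by apply: filterS (support_near0 nKx) => y uy; rewrite /eta uy P0 mul0r.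
    by rewrite (PhiK.2 x nKx) (gradL_near0 eta0) edotC edot0l !mulr0.
  have x0 := K0 Kx; have dx := d_gt0 x0.
  have du : differentiable u x by exact: (u_smooth [::]).
  have dd : differentiable d x by exact: (Hd_smooth [::] x0).
  have -> : gradL sigma (f \o d) x = (c * d x `^ b) *: gd x.
    apply: gradL_scale => j; have := is_derive_partial_comp j dd (fd _ dx).
    by move=> [_ <-].
  have -> : gradL sigma eta x = (P^`().[u x] * S.[d x]) *: gu x + (P.[u x] * S^`().[d x]) *: gd x.
    apply: gradL_lin => j.
    have h1 := is_derive_partial_comp j du (is_derive_horner P (u x)).
    have h2 := is_derive_partial_comp j dd (is_derive_horner S (d x)).
    rewrite [LHS](@derive_val _ _ _ _ _ _ _ (is_deriveM h1 h2)) /GRing.scale /=; ring.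
  rewrite enormZ powRM ?normr_ge0 ?enorm_ge0// edotZl edotC edotDl !edotZl -enorm_sqr.
  have -> : `|c * d x `^ b| `^ (q - 2) = phip q c * d x `^ (1 - Q) / (c * d x `^ b).
    rewrite -bq powRrM -(phip_ge0E q2 (powR_ge0 _ _)) -phipM /phip mulfK//.
    by rewrite mulf_neq0// gt_eqF// powR_gt0.
  rewrite PhiE; field.
  by rewrite c0 gt_eqF// powR_gt0.
have aPhi : supported_continuous K (fun x => phip q c * Phi x).
  by apply: supported_continuousM => // x _; exact: cst_continuous.
rewrite (intRNE cK aPhi) => -[]; rewrite integral_cZ// => /eqP.
rewrite mulf_eq0 => /orP[|/eqP//]; rewrite /phip mulf_eq0 (negbTE c0) orbF.
by rewrite powR_eq0 normr_eq0 (negbTE c0).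
Qed.

Lemma integral_c_approx0 f (C : R) : supported_continuous K f ->
  (forall e, 0 < e -> exists g, [/\ supported_continuous K g, integral_c g = 0 &
    forall x, K x -> `|f x - g x| <= e * C]) -> integral_c f = 0.
Proof.
move=> fK H; have [L L0 HL] := integral_c_bound cK.
apply: (@eq0_small _ _ (L * `|C|)) => e e0.
have [g [gK g0 fg]] := H e e0.
have hK : supported_continuous K (fun x => - 1 * g x + f x).
  by apply: supported_continuousD => //; apply: supported_continuousM => // x _; exact: cst_continuous.
have -> : integral_c f = integral_c (fun x => - 1 * g x + f x).
  by rewrite (integral_c_lin _ cK gK fK) g0; ring.
rewrite mulrCA; apply: HL => // x; rewrite mulN1r addrC.
have [Kx|nKx] := pselect (K x).
  by apply: le_trans (fg x Kx) _; rewrite ler_pM2l// ler_norm.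
by rewrite fK.2// gK.2// subrr normr0 mulr_ge0// ltW.
Qed.

(** [flux] is linear in [(F, F')] and in [(G, G')], with the remaining factors bounded on [K], so a
    C^1 error [e] in one pair costs at most [e * C]. [F] is replaced first with [G] fixed, then [G]
    with [F] already polynomial; [bound] serves both passes. *)
Lemma flux_C1 (q Q r0 : R) (F F' G G' : R -> R) :
  (forall q : R, 2 <= q ->
     (q != Q -> Lp_harmonic_weak sigma q [set x | x != 0]
          (fun x => powR (d x) ((q - Q) / (q - 1)))) /\
     (q = Q -> Lp_harmonic_weak sigma q [set x | x != 0] (fun x => - ln (d x)))) ->
  2 <= q -> F 0 = 0 -> (forall t : R, is_derive t 1 F (F' t)) -> continuous F' ->
  0 < r0 -> (forall x, K x -> d x <= r0) ->
  (forall r : R, 0 < r <= r0 -> is_derive r 1 G (G' r)) ->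
  (forall r : R, 0 < r <= r0 -> {for r, continuous G'}) ->
  integral_c (flux q Q F F' G G') = 0.
Proof.
move=> harm q2 F0 Fd F'c r00 Kr0 Gd G'c.
have dc (k : R -> R) (t dk : R) : is_derive t 1 k dk -> {for t, continuous k}.
  by move=> [kd _]; apply/differentiable_continuous/derivable1_diffP.
have Kd x : K x -> 0 < d x <= r0 by move=> Kx; rewrite d_gt0 ?K0//= Kr0.
have Fc : continuous F by move=> t; exact: dc.
have GcK x : K x -> {for d x, continuous G} by move=> /Kd/Gd; exact: dc.
have G'cK x : K x -> {for d x, continuous G'} by move=> /Kd/G'c.
pose w x := d x `^ (1 - Q) * enorm (gd x) `^ (q - 2).
have wc x : K x -> {for x, continuous w}.
  move=> Kx; apply: mul_continuous_at; first exact: d_powR_continuous_at.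
  apply: enorm_powR_continuous_at; last by rewrite subr_ge0.
  by move=> i; exact: gd_continuous_at.
have ec x : K x -> {for x, continuous (fun y => edot (gu y) (gd y))}.
  move=> Kx; apply: edot_continuous_at => i; first exact: gu_continuous_at.
  exact: gd_continuous_at.
have nc x : K x -> {for x, continuous (fun y => enorm (gd y) ^+ 2)}.
  have -> : (fun y => enorm (gd y) ^+ 2) = (fun y => edot (gd y) (gd y)).
    by apply/funext => y; rewrite enorm_sqr.
  by move=> Kx; apply: edot_continuous_at => i; exact: gd_continuous_at.
have bound (a b : V -> R) : (forall x, K x -> {for x, continuous a}) ->
    (forall x, K x -> {for x, continuous b}) -> exists C, forall x, K x ->
    forall s t e, `|s| <= e -> `|t| <= e ->
    `|w x * (s * a x * edot (gu x) (gd x) + t * b x * enorm (gd x) ^+ 2)| <= e * C.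
  move=> ac bc.
  have [C1 C10 HC1] := @bounded_on_compact _ _ K (fun x => w x * (a x * edot (gu x) (gd x))) cK
    (fun x Kx => mul_continuous_at (wc x Kx) (mul_continuous_at (ac x Kx) (ec x Kx))).
  have [C2 C20 HC2] := @bounded_on_compact _ _ K (fun x => w x * (b x * enorm (gd x) ^+ 2)) cK
    (fun x Kx => mul_continuous_at (wc x Kx) (mul_continuous_at (bc x Kx) (nc x Kx))).
  exists (C1 + C2) => x Kx s t e se te.
  have -> : w x * (s * a x * edot (gu x) (gd x) + t * b x * enorm (gd x) ^+ 2) =
    s * (w x * (a x * edot (gu x) (gd x))) + t * (w x * (b x * enorm (gd x) ^+ 2)) by ring.
  apply: le_trans (ler_normD _ _) _; rewrite !normrM -!normrM mulrDr.
  by rewrite lerD// normrM ler_pM// ?HC1 ?HC2.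
have comp_u (k : R -> R) x : continuous k -> {for x, continuous (fun y => k (u y))}.
  by move=> kc; apply: (@continuous_comp _ _ _ u k); [exact: u_continuous|exact: kc].
have comp_d (k : R -> R) x : {for d x, continuous k} -> {for x, continuous (fun y => k (d y))}.
  by move=> kc; apply: (@continuous_comp _ _ _ d k) => //; exact: Hd_cont.
have [C HC] := bound (fun x => G (d x)) (fun x => G' (d x))
  (fun x Kx => comp_d _ _ (GcK x Kx)) (fun x Kx => comp_d _ _ (G'cK x Kx)).
have [M M0 HM] := @bounded_on_compact _ _ K u cK (fun x _ => @u_continuous x).
apply: (@integral_c_approx0 _ C); first exact: flux_supported.
move=> e e0.
(* [M + 1] keeps the interval nondegenerate when [M = 0]. *)
have M1 : - (M + 1) < M + 1 by lra.
have M2 : - (M + 1) <= 0 <= M + 1 by apply/andP; split; lra.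
have [P [P0 HP]] := weierstrass_C1 M1 M2 (fun t _ => Fd t) (fun t _ => @F'c t) e0.
rewrite F0 in P0.
have PGK : supported_continuous K (flux q Q (horner P) (horner P^`()) G G').
  by apply: flux_supported => //; exact: continuous_horner.
exists (flux q Q (horner P) (horner P^`()) G G'); split => //; last first.
  move=> x Kx; have uM : - (M + 1) <= u x <= M + 1.
    by rewrite -ler_norml (le_trans (HM x Kx))// lerDl.
  have [h1 h2] := HP _ uM; have := HC x Kx _ _ e h2 h1; congr (`|_| <= _).
  by rewrite /flux /w; ring.
have [C' HC'] := bound (fun x => P^`().[u x]) (fun x => P.[u x])
  (fun x _ => comp_u _ x (@continuous_horner _ P^`())) (fun x _ => comp_u _ x (@continuous_horner _ P)).
apply: (@integral_c_approx0 _ C') => // e' e'0.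
have [D D0 HD] := @bounded_on_compact _ _ K (fun x => d x `^ (-1)) cK
  (fun x Kx => @d_powR_continuous_at x (-1) Kx).
(* The bound [D] on [1 / d] over [K] yields a positive lower bound for [d] there, so [G] is
   approximated away from 0; [r0 / 2] ensures [a < r0]. *)
pose a := Num.min (r0 / 2) (D + 1)^-1.
have a0 : 0 < a by rewrite lt_min divr_gt0//= invr_gt0; lra.
have ar0 : a < r0 by rewrite gt_min; apply/orP; left; lra.
have Ka x : K x -> a <= d x.
  move=> Kx; rewrite ge_min; apply/orP; right.
  have /andP[dx _] := Kd x Kx; have := HD x Kx.
  rewrite ger0_norm ?powR_ge0// powR_inv1 ?(ltW dx)// => dD.
  rewrite -[leRHS]invrK lef_pV2 ?posrE ?invr_gt0//; lra.
have aar : a <= a <= r0 by rewrite lexx ltW.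
have ar (x : R) : a <= x <= r0 -> 0 < x <= r0.
  by move=> /andP[ax xr]; rewrite xr andbT (lt_le_trans a0).
have [S [_ HS]] := weierstrass_C1 ar0 aar (fun t at0 => Gd t (ar t at0))
  (fun t at0 => @G'c t (ar t at0)) e'0.
exists (flux q Q (horner P) (horner P^`()) (horner S) (horner S^`())); split.
- by apply: flux_supported => //; try (move=> ? _); exact: continuous_horner.
- exact: flux_poly.
- move=> x Kx; have dS : a <= d x <= r0 by rewrite Ka//= Kr0.
  have [h1 h2] := HS _ dS; have := HC' x Kx _ _ e' h1 h2; congr (`|_| <= _).
  by rewrite /flux /w; ring.
Qed.

End Flux.

(** * The Hardy inequality *)

Lemma le_of_left_limit {R : realType} (f : R -> R) (a x : R) : 0 < a ->
  {for a, continuous f} -> (forall t, 0 < t < a -> f t <= x) -> f a <= x.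
Proof.
move=> a0 fc H; rewrite leNgt; apply/negP => xfa.
have fl : f t @[t --> a^'-] --> f a by exact: cvg_at_left_filter fc.
have n1 : \forall t \near a^'-, x < f t by exact: (cvgr_gt _ fl).
have n2 : \forall t \near a^'-, 0 < t by exact: nbhs_left_gt.
have n3 : \forall t \near a^'-, t < a by exact: nbhs_left_lt.
have n123 : \forall t \near a^'-, x < f t /\ 0 < t < a.
  by apply: filterS3 n1 n2 n3 => t xt t0 ta; rewrite xt t0.
have [t [xt ta]] := @filter_ex _ _ (at_left_proper_filter a) _ n123.
by have := H t ta; rewrite leNgt xt.
Qed.

Unset Implicit Arguments.

Theorem mainTheorem4
  (R : realType) (h N : nat) (hN : (h <= N)%N)
  (sigma : 'I_h -> 'I_N -> 'rV[R]_N -> R)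
  (Hsig_cont : forall i j, continuous (sigma i j))
  (Hsig_der : forall i j x, derivable (sigma i j) x (evec j))
  (Hsig_dcont : forall i j, continuous (partial j (sigma i j)))
  (beta : 'I_N -> R) (Hbeta : forall j, 0 < beta j)
  (Hhom : forall (i : 'I_h) (lam : R) (f : 'rV[R]_N -> R), 0 < lam ->
     smooth_on setT f -> forall x,
       Xop sigma i (f \o dil beta lam) x = lam * Xop sigma i f (dil beta lam x))
  (d : 'rV[R]_N -> R)
  (Hd_cont : continuous d)
  (Hd_smooth : smooth_on [set x | x != 0] d)
  (Hd_nonneg : forall x, 0 <= d x)
  (Hd_zero : forall x, d x = 0 <-> x = 0)
  (Hd_hom : forall (lam : R) x, 0 < lam -> d (dil beta lam x) = lam * d x)
  (Hd_harm : forall q : R, 2 <= q ->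
     (q != homdim beta ->
        Lp_harmonic_weak sigma q [set x | x != 0]
          (fun x => powR (d x) ((q - homdim beta) / (q - 1)))) /\
     (q = homdim beta ->
        Lp_harmonic_weak sigma q [set x | x != 0] (fun x => - ln (d x))))
  (p : R) (hp : 2 <= p)
  (phi : R -> R) (Hphi : nu_ode_sol p phi)
  (nu : R) (Hnu : first_pos_zero phi nu) :
  (powR 2 (- p) <= lambda_p p <= p * powR 2 (1 - p)) /\
  lambda_p (2 : R) = 1 /\
  forall (alpha theta r0 : R) (u : 'rV[R]_N -> R),
    0 <= alpha -> 0 < r0 ->
    Cc_infty (dball d r0 `\ 0) u ->
    let B := dball d r0 in
    let gd := gradL sigma d in
    let gu := gradL sigma u in
    (intRN_on B (fun x => (powR (enorm (gu x)) p / powR (d x) (p * (theta - 1))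
                          * powR (enorm (gd x)) alpha)%R)
     >= intRN_on B (fun x => (powR `|edot (gu x) (gd x) / enorm (gd x)| p
                          * powR (enorm (gd x)) alpha / powR (d x) (p * (theta - 1)))%R))%E /\
    (intRN_on B (fun x => (powR `|edot (gu x) (gd x) / enorm (gd x)| p
                          * powR (enorm (gd x)) alpha / powR (d x) (p * (theta - 1)))%R)
     >= (powR `|(homdim beta - p * theta) / p| p)%:E
          * intRN_on B (fun x => (powR `|u x| p / powR (d x) (p * theta)
                          * powR (enorm (gd x)) (alpha + p))%R)
        + (lambda_p p * powR nu p / powR r0 p)%:E
          * intRN_on B (fun x => (powR `|u x| p / powR (d x) (p * (theta - 1))
                          * powR (enorm (gd x)) (alpha + p))%R))%E.
Proof.
split; first by rewrite lambda_p_ge// lambda_p_upper.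
split; first exact: lambda_2.
move=> alpha theta r0 u a0 r00 [u_smooth [cK KB]] B gd gu.
have nonneg x : 0 <= enorm (gd x) by exact: enorm_ge0.
split.
  apply: le_iint => x; rewrite lee_fin ler_wpM2l ?indic_ge0//.
  rewrite -mulrA [leRHS]mulrAC -[leRHS]mulrA ler_wpM2r//.
    by rewrite mulr_ge0 ?powR_ge0// invr_ge0 powR_ge0.
  by rewrite ge0_ler_powR ?nnegrE ?enorm_ge0 ?norm_edot_div//; lra.
have K0 x : support_of u x -> x != 0 by move=> /KB[_ /eqP].
have Kr0 x : support_of u x -> d x <= r0 by move=> /KB[].
have Kd x : support_of u x -> 0 < d x <= r0.
  by move=> Kx; rewrite (d_gt0 Hd_nonneg Hd_zero) ?K0//= Kr0.
set J := intRN_on B (fun x => (powR `|edot (gu x) (gd x) / enorm (gd x)| p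
  * powR (enorm (gd x)) alpha / powR (d x) (p * (theta - 1)))).
pose i1 x := powR `|u x| p / powR (d x) (p * theta) * powR (enorm (gd x)) (alpha + p).
pose i2 x := powR `|u x| p / powR (d x) (p * (theta - 1)) * powR (enorm (gd x)) (alpha + p).
have iK (s : R) : supported_continuous (support_of u)
    (fun x => powR `|u x| p / powR (d x) s * powR (enorm (gd x)) (alpha + p)).
  split => x Kx; last first.
    rewrite (nbhs_singleton (support_near0 Kx)) normr0 powR0 ?mul0r// gt_eqF//; lra.
  apply: mul_continuous_at; last first.
    apply: enorm_powR_continuous_at; last by lra.
    by move=> i; exact: (gd_continuous_at Hsig_cont Hd_smooth K0).
  have -> : (fun y => powR `|u y| p / powR (d y) s) = (fun y => powR `|u y| p * powR (d y) (- s)).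
    by apply/funext => y; rewrite powRN.
  apply: mul_continuous_at; last exact: (d_powR_continuous_at Hd_cont Hd_nonneg Hd_zero K0).
  apply: (@continuous_comp _ _ _ u (fun t => `|t| `^ p)); first exact: u_continuous.
  by apply: powR_norm_at; left; lra.
have i1K : supported_continuous (support_of u) i1 by exact: iK.
have i2K : supported_continuous (support_of u) i2 by exact: iK.
have onB f : supported_continuous (support_of u) f -> intRN_on B f = (integral_c f)%:E.
  move=> fK; rewrite /intRN_on -(intRNE cK fK); congr intRN; apply/funext => x /=; congr EFin.
  rewrite indicE; have [Bx|Bx] := pselect (B x); first by rewrite mem_set// mul1r.
  by rewrite fK.2 ?mulr0// => /KB[].
rewrite [X in (_ * X + _)%E](onB _ i1K) [X in (_ + _ * X)%E](onB _ i2K).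
rewrite -!EFinM -EFinD.
have main mu : 0 < mu -> mu * r0 < nu ->
    ((powR `|(homdim beta - p * theta) / p| p * integral_c i1 +
      lambda_p p * powR mu p * integral_c i2)%:E <= J)%E.
  move=> mu0 mur0.
  have [g [g' [m gP]]] := riccati hp Hphi Hnu mu0 mur0.
  set kap := (homdim beta - p * theta) / p.
  have p0 : p != 0 by rewrite gt_eqF//; lra.
  have kapE : p * kap = homdim beta - p * theta by rewrite /kap mulrC divfK.
  pose k r := - phip p kap + lambda_p p * g r.
  pose G r := powR r (p * kap) * k r.
  pose G' r := powR r (p * kap) * (p * kap * k r / r + lambda_p p * g' r).
  have dk r : 0 < r <= r0 -> is_derive r 1 k (lambda_p p * g' r).
    move=> /gP[dg _ _ _].
    have h1 := is_deriveD (is_derive_cst (- phip p kap) r (1 : R)) (is_deriveZ (lambda_p p) dg).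
    by apply: is_derive_eq h1 _; rewrite add0r.
  have ck r : 0 < r <= r0 -> {for r, continuous k} by move=> /dk; exact: is_derive_continuous.
  have cpow (r s : R) : 0 < r -> {for r, continuous (fun t => powR t s)}.
    by move=> rpos; exact: is_derive_continuous (is_derive1_powR s rpos).
  have fl0 : integral_c (flux sigma d u (alpha + p) (homdim beta) (fun t => powR `|t| p)
      (fun t => p * phip p t) G G') = 0.
    apply: (@flux_C1 _ _ _ sigma Hsig_cont d Hd_cont Hd_smooth Hd_nonneg Hd_zero u u_smooth cK K0 _ _ r0) => //.
    - lra.
    - by rewrite normr0 powR0.
    - by move=> t; exact: is_derive_powR_norm.
    - by move=> t; apply: mul_continuous_at; [exact: cst_continuous|exact: phip_continuous].
    - move=> r rr; have /andP[rpos _] := rr.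
      have h1 := is_deriveM (is_derive1_powR (p * kap) rpos) (dk r rr).
      apply: is_derive_eq h1 _; rewrite /G' /GRing.scale /= powR_sub1//; field.
      by rewrite gt_eqF.
    - move=> r rr; have /andP[rpos _] := rr.
      apply: mul_continuous_at; first exact: cpow.
      apply: add_continuous_at; last first.
        by apply: mul_continuous_at; [exact: cst_continuous|have [] := gP _ rr].
      apply: mul_continuous_at.
        by apply: mul_continuous_at; [exact: cst_continuous|exact: ck].
      by apply: cvgV; [rewrite gt_eqF|exact: cvg_id].
  set fl := flux _ _ _ _ _ _ _ _ _ in fl0.
  have flK : supported_continuous (support_of u) fl.
    apply: flux_supported => //.
    - lra.
    - by move=> t; apply: powR_norm_at; left; lra.
    - by move=> t; apply: mul_continuous_at; [exact: cst_continuous|exact: phip_continuous].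
    - by rewrite normr0 powR0.
    - move=> x /Kd dx; have /andP[dpos _] := dx.
      by apply: mul_continuous_at; [exact: cpow|exact: ck].
    - move=> x /Kd dx; have /andP[rpos _] := dx.
      apply: mul_continuous_at; first exact: cpow.
      apply: add_continuous_at; last first.
        by apply: mul_continuous_at; [exact: cst_continuous|have [] := gP _ dx].
      apply: mul_continuous_at.
        by apply: mul_continuous_at; [exact: cst_continuous|exact: ck].
      by apply: cvgV; [rewrite gt_eqF|exact: cvg_id].
  have scale (c : R) f f' : supported_continuous (support_of u) f ->
      supported_continuous (support_of u) f' ->
      supported_continuous (support_of u) (fun x => c * f x + f' x).
    move=> fK f'K; apply: supported_continuousD => //.
    by apply: supported_continuousM => // x _; exact: cst_continuous.
  have K2 := scale (lambda_p p * powR mu p) _ _ i2K flK.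
  have K1 := scale (powR `|kap| p) _ _ i1K K2.
  (* The vanishing flux joins the side where additivity is known; only monotonicity is asked of
     [J]. *)
  have -> : powR `|kap| p * integral_c i1 + lambda_p p * powR mu p * integral_c i2 =
      integral_c (fun x => powR `|kap| p * i1 x + (lambda_p p * powR mu p * i2 x + fl x)).
    by rewrite (integral_c_lin _ cK i1K K2) (integral_c_lin _ cK i2K flK) fl0 addr0.
  rewrite -(intRNE cK K1); apply: le_iint => x /=; rewrite lee_fin.
  have [Kx|nKx] := pselect (support_of u x); last first.
    rewrite (i1K.2 x nKx) (K2.2 x nKx) mulr0 addr0 mulr_ge0 ?indic_ge0//.
    by rewrite !mulr_ge0 ?powR_ge0// invr_ge0 powR_ge0.
  have Bx : B x by have [] := KB x Kx.
  rewrite indicE mem_set// mul1r.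
  have /andP[dpos _] := Kd x Kx.
  have [_ _ gm dgm] := gP _ (Kd x Kx).
  have n0 : enorm (gd x) = 0 -> edot (gu x) (gd x) = 0.
    by move=> /enorm_eq0 ->; rewrite edotC edot0l.
  have PW := pointwise_multiplier (u x) hp a0 kapE dpos (nonneg x) n0 dgm.
  cbv zeta in PW; apply: le_trans PW.
  by rewrite addrA /i1 /i2 /fl /flux /G /G' /k gm.
(* Finiteness of [J] is not known. The value +oo is harmless, and -oo contradicts [main] at any
   admissible [mu], here [nu / (2 * r0)]; a real value allows the passage to the limit. *)
have [->|] := eqVneq J +oo%E; first by rewrite leey.
case: J main => [j main _|//|main _]; last first.
  have := main (nu / (2 * r0)).
  have nu0 : 0 < nu by case: Hnu.
  rewrite divr_gt0 ?mulr_gt0// invfM mulrA divfK ?gt_eqF//.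
  have -> : nu / 2 < nu by lra.
  by move=> /(_ isT isT); rewrite leeNy_eq.
rewrite lee_fin.
have nu0 : 0 < nu by case: Hnu.
(* Both integrals are independent of [mu], so the limit only concerns the power [t^p] at
   [t = nu / r0]. *)
pose f (t : R) := powR `|(homdim beta - p * theta) / p| p * integral_c i1 +
      lambda_p p * powR t p * integral_c i2.
have -> : powR `|(homdim beta - p * theta) / p| p * integral_c i1 +
   lambda_p p * powR nu p / powR r0 p * integral_c i2 = f (nu / r0).
  have rV : powR r0^-1 p = (powR r0 p)^-1.
    by rewrite -powR_inv1 ?ltW// -powRrM mulN1r powRN.
  by rewrite /f powRM ?invr_ge0 ?ltW// rV !mulrA.
apply: le_of_left_limit; first by rewrite divr_gt0.
  apply: add_continuous_at; first exact: cst_continuous.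
  apply: mul_continuous_at; last exact: cst_continuous.
  apply: mul_continuous_at; first exact: cst_continuous.
  by apply: is_derive_continuous (is_derive1_powR p _); rewrite divr_gt0.
move=> t /andP[t0 tnu]; rewrite -lee_fin; apply: main => //.
by rewrite -ltr_pdivlMr.
Qed.
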